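(* Let $n\ge 1$ be an integer. The $\mathcal{SL}_n$-radius for the class $\mathcal{S}_n$ is $$R_{\mathcal{SL}_n}(\mathcal{S}_n)=\left\{\frac{\sqrt{2}-1}{n+\sqrt{n^2+(\sqrt{2}-1)^2}}\right\}^{1/n}.$$ This radius is sharp (it cannot be replaced by a larger number).
   Context: $\mathbb{D}=\{z\in\mathbb{C}:|z|<1\}$, $\mathbb{D}_r=\{z\in\mathbb{C}:|z|<r\}$. For an integer $n\ge1$, $\mathcal{A}_n$ is the class of analytic functions on $\mathbb{D}$ of the form $f(z)=z+\sum_{k\ge n+1}a_kz^k$. $\mathcal{P}_n$ is the class of analytic functions $p(z)=1+c_nz^n+c_{n+1}z^{n+1}+\cdots$ on $\mathbb{D}$ with $\operatorname{Re}p(z)>0$ for all $z\in\mathbb{D}$. $\mathcal{S}_n:=\{f\in\mathcal{A}_n: f(z)/z\in\mathcal{P}_n\}$. $\mathcal{SL}_n$ is the class of $f\in\mathcal{A}_n$ such that $\left|\left(zf'(z)/f(z)\right)^2-1\right|<1$ for all $z\in\mathbb{D}$ (with $zf'(z)/f(z)$ taken to be $1$ at $z=0$). For a class $\mathcal{M}\subset\mathcal{A}_n$, the $\mathcal{SL}_n$-radius $R_{\mathcal{SL}_n}(\mathcal{M})$ is the largest number $R\in(0,1]$ such that for every $f\in\mathcal{M}$ and every $r<R$ one has $\left|\left(zf'(z)/f(z)\right)^2-1\right|<1$ for all $z\in\mathbb{D}_r$. *)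

(* Defs.v *)
From Stdlib Require Import Reals.
From Coquelicot Require Import Coquelicot.
Open Scope R_scope.

Definition disk (r : R) (z : C) : Prop := Cmod z < r.

(* A function on a disk is represented by a total function C -> C; every
   definition below depends only on its values on the unit disk. *)
Definition analytic_on_disk (r : R) (f : C -> C) : Prop :=
  forall z : C, disk r z -> ex_derive (K := C_AbsRing) (V := C_NormedModule) f z.

Definition power_series_on_disk (r : R) (a : nat -> C) (f : C -> C) : Prop :=
  forall z : C, disk r z ->
    is_pseries (K := C_AbsRing) (V := C_NormedModule) a z (f z).

Definition class_A (n : nat) (f : C -> C) : Prop :=
  analytic_on_disk 1 f /\
  exists a : nat -> C,
    a 0%nat = RtoC 0 /\ a 1%nat = RtoC 1 /\
    (forall k : nat, (1 < k < n + 1)%nat -> a k = RtoC 0) /\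
    power_series_on_disk 1 a f.

Definition class_P (n : nat) (p : C -> C) : Prop :=
  analytic_on_disk 1 p /\
  (exists c : nat -> C,
    c 0%nat = RtoC 1 /\
    (forall k : nat, (0 < k < n)%nat -> c k = RtoC 0) /\
    power_series_on_disk 1 c p) /\
  (forall z : C, disk 1 z -> 0 < Re (p z)).

(* f(z)/z, with the removable singularity at 0 filled by f'(0) = 1. *)
Definition over_id (f : C -> C) (z : C) : C :=
  if Ceq_dec z (RtoC 0) then RtoC 1 else (f z / z)%C.

Definition class_S (n : nat) (f : C -> C) : Prop :=
  class_A n f /\ class_P n (over_id f).

(* z f'(z)/f(z), with the value 1 at z = 0.  At any other zero of f, where the
   quotient has a pole, Cinv 0 = 0 gives the value 0; there
   SL_cond is false, as it should be, since |0^2 - 1| = 1. *)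
Definition log_quot (f : C -> C) (z : C) : C :=
  if Ceq_dec z (RtoC 0) then RtoC 1 else (z * C_derive f z / f z)%C.

Definition SL_cond (f : C -> C) (z : C) : Prop :=
  Cmod (log_quot f z * log_quot f z - RtoC 1)%C < 1.

Definition class_SL (n : nat) (f : C -> C) : Prop :=
  class_A n f /\ forall z : C, disk 1 z -> SL_cond f z.

Definition SL_admissible (M : (C -> C) -> Prop) (R0 : R) : Prop :=
  0 < R0 <= 1 /\
  forall f : C -> C, M f -> forall r : R, r < R0 ->
    forall z : C, disk r z -> SL_cond f z.

(* R0 is the SL_n-radius of M, i.e. the largest admissible number; n enters
   only through the inclusion of M in class_A n. *)
Definition is_SL_radius (n : nat) (M : (C -> C) -> Prop) (R0 : R) : Prop :=
  (forall f : C -> C, M f -> class_A n f) /\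
  SL_admissible M R0 /\
  (forall R1 : R, SL_admissible M R1 -> R1 <= R0).

Lemma is_SL_radius_unique (n : nat) (M : (C -> C) -> Prop) (R0 R1 : R) :
  is_SL_radius n M R0 -> is_SL_radius n M R1 -> R0 = R1.
Proof.
intros [_ [A0 B0]] [_ [A1 B1]].
apply Rle_antisym; auto.
Qed.

(* Main.v *)
Require Import Defs.
From Stdlib Require Import Reals Lra Lia.
From Coquelicot Require Import Coquelicot.
Open Scope R_scope.

(** Let f = z p with p in the class P_n.  Then z f'/f = 1 + z p'/p, and for
    w = z p'/p one has |(1 + w)^2 - 1| = |w| |w + 2| < 1 as soon as
    |w| < sqrt 2 - 1.  So everything rests on the sharp estimate
      |z p'(z)| (1 - r^(2n)) <= 2 n r^n Re p(z),   r = |z|,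
    whose right-hand side is compared with sqrt 2 - 1 by solving a quadratic
    equation in r^n ([radius_pow_spec]).  For z (1 + z^n) / (1 - z^n) the modulus
    |(z f'/f)^2 - 1| is equal to 1 at the real point equal to the radius
    ([extremal_not_SL_cond]).

    The estimate is the Schwarz-Pick lemma for the function phi defined by
    (p - 1) / (p + 1) = z^n phi.  It is proved here by integration against the
    positive weight Re p on the unit circle, after a dilation that makes the
    power series of p absolutely convergent there.  Integrals are limits of
    averages over roots of unity; power series may be integrated term by term
    ([mean_series]), which gives Cauchy's formulas for p(z) and p'(z) with the
    kernel K(w) = 1 / (1 - z conj w), and shows that the weight Re p has total
    mass 1, vanishing moments of index 1 to n - 1, and
      E K = m,   E K^2 = m + z p'(z) / 2,   where m = (p(z) + 1) / 2.

    Put a = z conj w and sigma = 1 + a + ... + a^(n-1).  Since the first moments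
    vanish, psi = K - m sigma is orthogonal to the span of 1, ..., a^(n-1), and
    this orthogonality evaluates both integrals
      E [(conj a)^(n-1) psi^2] = r^(2n-2) (z p'(z) / 2 - n m (m - 1)),
      E |psi|^2 = (r^(2n) |m|^2 - |m - 1|^2) / (1 - r^2).
    The modulus of the first integrand is r^(n-1) |psi|^2, so the triangle
    inequality bounds z p'(z) / 2 - n m (m - 1): this is
    [schwarz_pick_moments].  The passage to the estimate of z p' is the
    elementary inequality [schwarz_pick_to_bound], where
    Re p(z) = |m|^2 - |m - 1|^2. *)

(* Restates an equation between complex numbers at type C, where ring works. *)
Ltac eq_in_C := match goal with |- ?x = ?y => change (@eq C x y) end.

(** * Limits of complex sequences *)

Lemma Clim_iff (u : nat -> C) (l : C) :
  filterlim u eventually (locally l) <->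
  forall eps : posreal, eventually (fun N => Cmod (u N - l) < eps).
Proof.
exact (filterlim_locally_ball_norm (U := C_NormedModule) u l).
Qed.

Lemma Clim_unique (u : nat -> C) (l l' : C) :
  filterlim u eventually (locally l) -> filterlim u eventually (locally l') ->
  l = l'.
Proof.
exact (filterlim_locally_unique (V := C_NormedModule) u l l').
Qed.

Lemma Clim_ext (u v : nat -> C) (l : C) :
  (forall N, u N = v N) ->
  filterlim u eventually (locally l) -> filterlim v eventually (locally l).
Proof. intros H; apply filterlim_ext, H. Qed.

Lemma Clim_plus (u v : nat -> C) (l m : C) :
  filterlim u eventually (locally l) -> filterlim v eventually (locally m) ->
  filterlim (fun N => (u N + v N)%C) eventually (locally (l + m)%C).
Proof.
intros Hu Hv.
eapply filterlim_comp_2; [exact Hu | exact Hv |].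
exact (filterlim_plus (V := C_NormedModule) l m).
Qed.

Lemma Clim_scal (c : C) (u : nat -> C) (l : C) :
  filterlim u eventually (locally l) ->
  filterlim (fun N => (c * u N)%C) eventually (locally (c * l)%C).
Proof.
intros Hu.
exact (filterlim_comp _ _ _ _ _ _ _ _ Hu
         (filterlim_scal_r (V := C_NormedModule) c l)).
Qed.

Lemma Cconj_RtoC (x : R) : Cconj (RtoC x) = RtoC x.
Proof. apply injective_projections; simpl; ring. Qed.

Lemma Clim_conj (u : nat -> C) (l : C) :
  filterlim u eventually (locally l) ->
  filterlim (fun N => Cconj (u N)) eventually (locally (Cconj l)).
Proof.
rewrite !Clim_iff; intros H eps.
destruct (H eps) as [N0 HN]; exists N0; intros N HN0.
rewrite <- Cminus_conj, Cmod_conj; now apply HN.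
Qed.

Lemma Clim_Cmod (u : nat -> C) (l : C) :
  filterlim u eventually (locally l) ->
  is_lim_seq (fun N => Cmod (u N)) (Cmod l).
Proof.
intros H.
exact (filterlim_comp _ _ _ _ _ _ _ _ H (filterlim_norm (V := C_NormedModule) l)).
Qed.

Lemma Clim_Re (u : nat -> C) (l : C) :
  filterlim u eventually (locally l) ->
  is_lim_seq (fun N => Re (u N)) (Re l).
Proof.
rewrite Clim_iff; intros H.
apply is_lim_seq_spec; intros eps.
destruct (H eps) as [N0 HN]; exists N0; intros N HN0.
replace (Re (u N) - Re l) with (Re (u N - l)%C)
  by (destruct (u N), l; simpl; ring).
eapply Rle_lt_trans; [apply re_le_Cmod | now apply HN].
Qed.

(** The remainder of the majorant b does not involve a, so the estimate is
    uniform when a varies with a parameter and b does not. *)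
Lemma series_remainder (a : nat -> C) (b : nat -> R) (l : C) (B : R) (K : nat) :
  (forall k, Cmod (a k) <= b k) ->
  is_series (V := C_NormedModule) a l -> is_series b B ->
  Cmod (l - sum_n a K) <= B - sum_n b K.
Proof.
intros Hab Ha Hb.
assert (Hn : forall N, (K <= N)%nat ->
  Cmod (sum_n a N - sum_n a K) <= sum_n b N - sum_n b K).
{ intros N HN; induction HN as [|N HN IH].
  - replace (sum_n a K - sum_n a K)%C with (RtoC 0) by ring.
    rewrite Cmod_0; lra.
  - rewrite !sum_Sn; change plus with Cplus at 1; change plus with Rplus.
    replace (sum_n a N + a (S N) - sum_n a K)%C
      with ((sum_n a N - sum_n a K) + a (S N))%C by ring.
    eapply Rle_trans; [apply Cmod_triangle|]; specialize (Hab (S N)); lra. }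
assert (L1 : is_lim_seq (fun N => Cmod (sum_n a N - sum_n a K))
                        (Cmod (l - sum_n a K))).
{ apply Clim_Cmod, Clim_plus; [exact Ha | apply filterlim_const]. }
assert (L2 : is_lim_seq (fun N => sum_n b N - sum_n b K) (B - sum_n b K)).
{ apply (is_lim_seq_minus' _ _ B (sum_n b K)); [exact Hb | apply is_lim_seq_const]. }
refine (is_lim_seq_le_loc _ _ (Cmod (l - sum_n a K)) (B - sum_n b K) _ L1 L2).
exists K; exact Hn.
Qed.

(** * Means over the unit circle *)

Definition on_circle (w : C) : Prop := Cmod w = 1.

Definition root (N j : nat) : C :=
  (cos (INR j * (2 * PI / INR N)), sin (INR j * (2 * PI / INR N))).

(** The number of points is N + 1, so that no average is over the empty set. *)
Definition average (F : C -> C) (N : nat) : C :=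
  (/ RtoC (INR (S N)) * sum_n (fun j => F (root (S N) j)) N)%C.

(** The integral of F for the normalized arc length, as a relation: a value
    exists only when the averages converge. *)
Definition mean (F : C -> C) (v : C) : Prop :=
  filterlim (average F) eventually (locally v).

Lemma root_on_circle N j : on_circle (root N j).
Proof.
unfold on_circle, root, Cmod; simpl fst; simpl snd.
rewrite <- !Rsqr_pow2, Rplus_comm, sin2_cos2; apply sqrt_1.
Qed.

Lemma sum_n_C_ext_loc (a b : nat -> C) N :
  (forall k, (k <= N)%nat -> a k = b k) -> sum_n a N = sum_n b N.
Proof. apply sum_n_ext_loc. Qed.

Lemma sum_n_C_plus (a b : nat -> C) N :
  sum_n (fun k => (a k + b k)%C) N = (sum_n a N + sum_n b N)%C.
Proof. exact (sum_n_plus (G := C_AbelianMonoid) a b N). Qed.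

Lemma sum_n_C_scal (c : C) (a : nat -> C) N :
  sum_n (fun k => (c * a k)%C) N = (c * sum_n a N)%C.
Proof. exact (sum_n_mult_l (K := C_Ring) c a N). Qed.

Lemma sum_n_C_S (a : nat -> C) N :
  sum_n a (S N) = (sum_n a N + a (S N))%C.
Proof. exact (sum_Sn (G := C_AbelianMonoid) a N). Qed.

Lemma sum_n_C_conj (a : nat -> C) N :
  Cconj (sum_n a N) = sum_n (fun k => Cconj (a k)) N.
Proof.
induction N as [|N IH]; [now rewrite !sum_O|].
now rewrite !sum_n_C_S, Cplus_conj, IH.
Qed.

Lemma sum_n_C_const (c : C) N : sum_n (fun _ : nat => c) N = (INR (S N) * c)%C :> C.
Proof.
induction N as [|N IH]; [rewrite sum_O; simpl; ring|].
rewrite sum_n_C_S, IH, (S_INR (S N)), RtoC_plus; ring.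
Qed.

Lemma average_ext F G N :
  (forall w, on_circle w -> F w = G w) -> average F N = average G N.
Proof.
intros H; unfold average; f_equal; apply sum_n_C_ext_loc.
intros k _; apply H, root_on_circle.
Qed.

Lemma average_plus F G N :
  average (fun w => F w + G w)%C N = (average F N + average G N)%C.
Proof. unfold average; rewrite sum_n_C_plus; ring. Qed.

Lemma average_scal c F N :
  average (fun w => c * F w)%C N = (c * average F N)%C.
Proof. unfold average; rewrite sum_n_C_scal; ring. Qed.

Lemma INR_S_neq_0 N : RtoC (INR (S N)) <> RtoC 0.
Proof. intros H; apply RtoC_inj in H; revert H; apply not_0_INR; lia. Qed.

Lemma average_conj F N :
  average (fun w => Cconj (F w)) N = Cconj (average F N).
Proof.
unfold average.
rewrite Cmult_conj, Cinv_conj by apply INR_S_neq_0.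
now rewrite sum_n_C_conj, Cconj_RtoC.
Qed.

Lemma Cmod_average_le F G N :
  (forall w, on_circle w -> Cmod (F w) <= Re (G w)) ->
  Cmod (average F N) <= Re (average G N).
Proof.
intros H; unfold average.
assert (HS : 0 < INR (S N)) by (apply lt_0_INR; lia).
assert (HI : 0 <= / INR (S N)) by now apply Rlt_le, Rinv_0_lt_compat.
rewrite <- RtoC_inv by lra.
rewrite Cmod_mult, re_scal_l, Cmod_R, Rabs_pos_eq by exact HI.
apply Rmult_le_compat_l; [exact HI|].
assert (Hs : forall M, Cmod (sum_n (fun j => F (root (S N) j)) M) <=
                       Re (sum_n (fun j => G (root (S N) j)) M)).
{ induction M as [|M IH].
  - rewrite !sum_O; apply H, root_on_circle.
  - rewrite !sum_n_C_S, re_plus.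
    eapply Rle_trans; [apply Cmod_triangle|].
    apply Rplus_le_compat; [exact IH | apply H, root_on_circle]. }
apply Hs.
Qed.

Lemma mean_unique F v v' : mean F v -> mean F v' -> v = v'.
Proof. apply Clim_unique. Qed.

Lemma mean_ext F G v :
  (forall w, on_circle w -> F w = G w) -> mean F v -> mean G v.
Proof. intros H; apply Clim_ext; intros N; now apply average_ext. Qed.

Lemma mean_plus F G v v' :
  mean F v -> mean G v' -> mean (fun w => F w + G w)%C (v + v')%C.
Proof.
intros HF HG; eapply Clim_ext; [|exact (Clim_plus _ _ _ _ HF HG)].
intros N; now rewrite average_plus.
Qed.

Lemma mean_scal c F v : mean F v -> mean (fun w => c * F w)%C (c * v)%C.
Proof.
intros HF; eapply Clim_ext; [|exact (Clim_scal c _ _ HF)].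
intros N; now rewrite average_scal.
Qed.

Lemma mean_conj F v : mean F v -> mean (fun w => Cconj (F w)) (Cconj v).
Proof.
intros HF; eapply Clim_ext; [|exact (Clim_conj _ _ HF)].
intros N; now rewrite average_conj.
Qed.

Lemma mean_sum (F : nat -> C -> C) (v : nat -> C) N :
  (forall k, (k <= N)%nat -> mean (F k) (v k)) ->
  mean (fun w => sum_n (fun k => F k w) N) (sum_n v N).
Proof.
induction N as [|N IH]; intros H.
- rewrite sum_O.
  apply mean_ext with (F 0%nat); [intros w _; now rewrite sum_O | apply H; lia].
- rewrite sum_n_C_S.
  apply mean_ext with (fun w => sum_n (fun k => F k w) N + F (S N) w)%C.
  { intros w _; now rewrite sum_n_C_S. }
  apply mean_plus; [apply IH; intros k Hk|]; apply H; lia.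
Qed.

Lemma Cmod_mean_le F G v v' :
  (forall w, on_circle w -> Cmod (F w) <= Re (G w)) ->
  mean F v -> mean G v' -> Cmod v <= Re v'.
Proof.
intros H HF HG.
refine (is_lim_seq_le _ _ (Cmod v) (Re v') _ (Clim_Cmod _ _ HF) (Clim_Re _ _ HG)).
intros N; now apply Cmod_average_le.
Qed.

Lemma mean_1 : mean (fun _ => RtoC 1) (RtoC 1).
Proof.
apply Clim_ext with (fun _ => RtoC 1); [|apply filterlim_const].
intros N; unfold average.
rewrite sum_n_C_const; field; apply INR_S_neq_0.
Qed.

Lemma Cmod_average_const F B N :
  (forall w, on_circle w -> Cmod (F w) <= B) -> Cmod (average F N) <= B.
Proof.
intros H.
apply Rle_trans with (Re (average (fun _ => RtoC B) N)).
{ now apply Cmod_average_le. }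
right; unfold average.
rewrite sum_n_C_const, <- RtoC_inv, <- !RtoC_mult, re_RtoC by (apply not_0_INR; lia).
field; apply not_0_INR; lia.
Qed.

Lemma Cmod_mean_const F v B :
  (forall w, on_circle w -> Cmod (F w) <= B) -> mean F v -> Cmod v <= B.
Proof.
intros H HF.
refine (is_lim_seq_le _ _ (Cmod v) B _ (Clim_Cmod _ _ HF) (is_lim_seq_const B)).
intros N; now apply Cmod_average_const.
Qed.

Lemma root_pow N j k :
  (root N j ^ k)%C =
  (cos (INR k * (INR j * (2 * PI / INR N))), sin (INR k * (INR j * (2 * PI / INR N)))).
Proof.
induction k as [|k IH].
- simpl; rewrite Rmult_0_l, cos_0, sin_0; reflexivity.
- rewrite Cpow_S, IH, S_INR, Rmult_plus_distr_r, Rmult_1_l, cos_plus, sin_plus.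
  unfold root, Cmult; simpl; f_equal; ring.
Qed.

(** The sum of the k-th powers of the N-th roots of unity is a geometric sum of
    ratio different from 1 as soon as 0 < k < N. *)
Lemma mean_pow k : mean (fun w => w ^ S k)%C (RtoC 0).
Proof.
apply Clim_iff; intros eps; exists (S k); intros N HN.
replace (average (fun w => w ^ S k)%C N - 0)%C with (RtoC 0);
  [rewrite Cmod_0; apply cond_pos|].
set (x := (root (S N) 1 ^ S k)%C).
assert (Epow : forall j, (root (S N) j ^ S k)%C = (x ^ j)%C).
{ intros j; unfold x; rewrite <- Cpow_mult_r, Nat.mul_comm, Cpow_mult_r.
  f_equal; rewrite root_pow; unfold root; simpl INR; rewrite !Rmult_1_l; reflexivity. }
assert (HS : 0 < INR (S N)) by (apply lt_0_INR; lia).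
assert (HN1 : (x ^ S N)%C = RtoC 1).
{ unfold x; rewrite <- Cpow_mult_r, root_pow, mult_INR; simpl (INR 1).
  replace (INR (S k) * INR (S N) * (1 * (2 * PI / INR (S N))))
    with (0 + 2 * INR (S k) * PI) by (field; lra).
  rewrite cos_period, sin_period, cos_0, sin_0; reflexivity. }
assert (Hx : x <> RtoC 1).
{ intros Hx; assert (Hc : Re x = 1) by (rewrite Hx; reflexivity).
  unfold x in Hc; rewrite root_pow in Hc; unfold Re, fst in Hc; simpl (INR 1) in Hc.
  set (t := INR (S k) * (1 * (2 * PI / INR (S N)))) in *.
  replace t with (2 * (t / 2)) in Hc by field.
  rewrite cos_2a_sin in Hc.
  assert (Hs : 0 < sin (t / 2)).
  { assert (Ht : t / 2 = INR (S k) / INR (S N) * PI) by (unfold t; field; lra).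
    assert (0 < INR (S k)) by (apply lt_0_INR; lia).
    assert (INR (S k) < INR (S N)) by (apply lt_INR; lia).
    assert (0 < INR (S k) / INR (S N)) by (apply Rdiv_lt_0_compat; lra).
    assert (INR (S k) / INR (S N) < 1) by (apply Rlt_div_l; lra).
    pose proof PI_RGT_0.
    apply sin_gt_0; rewrite Ht; nra. }
  nra. }
assert (Egeom : forall M, ((x - 1) * sum_n (fun j => x ^ j)%C M)%C = (x ^ S M - 1)%C).
{ induction M as [|M IH]; [rewrite sum_O; simpl; ring|].
  rewrite sum_n_C_S, Cmult_plus_distr_l, IH, !Cpow_S; ring. }
unfold average.
rewrite (sum_n_C_ext_loc _ (fun j => x ^ j)%C) by (intros j _; apply Epow).
replace (sum_n (fun j => x ^ j)%C N) with (RtoC 0); [ring|].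
specialize (Egeom N); rewrite HN1 in Egeom.
destruct (Ceq_dec (sum_n (fun j => x ^ j)%C N) 0) as [E|E]; [now rewrite E|].
exfalso; apply (Cmult_neq_0 (x - 1)%C _) in E;
  [apply E; rewrite Egeom; ring|].
intros E'; apply Hx; replace x with ((x - 1) + 1)%C by ring; rewrite E'; ring.
Qed.

(** Means may be taken term by term in a series that is dominated on the
    circle: the averages are bounded by the supremum, so the remainders of the
    series contribute uniformly little. *)
Lemma mean_series (F : nat -> C -> C) (G : C -> C) (b : nat -> R) (v : nat -> C) :
  (forall k w, on_circle w -> Cmod (F k w) <= b k) -> ex_series b ->
  (forall w, on_circle w -> is_series (V := C_NormedModule) (fun k => F k w) (G w)) ->
  (forall k, mean (F k) (v k)) ->
  exists l, is_series (V := C_NormedModule) v l /\ mean G l.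
Proof.
intros HF [B HB] HG Hv.
assert (Hvb : forall k, Cmod (v k) <= b k)
  by (intros k; apply (Cmod_mean_const (F k)); auto).
destruct (ex_series_le (V := C_CompleteNormedModule) v b Hvb (ex_intro _ B HB)) as [l Hl].
exists l; split; [exact Hl|].
apply Clim_iff; intros eps.
assert (He : 0 < eps / 3) by (pose proof (cond_pos eps); lra).
assert (HK : exists K, B - sum_n b K < eps / 3).
{ assert (HB' : is_lim_seq (sum_n b) B) by exact HB.
  apply is_lim_seq_spec in HB'.
  destruct (HB' (mkposreal _ He)) as [K HK]; exists K.
  specialize (HK K (le_n K)); apply Rabs_def2 in HK; simpl in HK; lra. }
destruct HK as [K HK].
assert (Hm := mean_sum F v K (fun k _ => Hv k)).
apply Clim_iff with (eps := mkposreal _ He) in Hm.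
destruct Hm as [N0 HN0]; exists N0; intros N HN; specialize (HN0 N HN); simpl in HN0.
set (T := average (fun w => sum_n (fun k => F k w) K) N) in *.
replace (average G N - l)%C
  with ((average G N - T) + (T - sum_n v K) + (sum_n v K - l))%C by ring.
assert (H1 : Cmod (average G N - T) <= B - sum_n b K).
{ replace (average G N - T)%C
    with (average (fun w => G w + (-(1)) * sum_n (fun k => F k w) K)%C N).
  2:{ rewrite average_plus, average_scal; unfold T; ring. }
  apply Cmod_average_const; intros w Hw.
  replace (G w + (-(1)) * sum_n (fun k => F k w) K)%C
    with (G w - sum_n (fun k => F k w) K)%C by ring.
  apply (series_remainder (fun k => F k w)); auto. }
assert (H2 : Cmod (sum_n v K - l) <= B - sum_n b K).
{ replace (sum_n v K - l)%C with (- (l - sum_n v K))%C by ring.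
  rewrite Cmod_opp; now apply series_remainder. }
eapply Rle_lt_trans; [apply Cmod_triangle|].
eapply Rle_lt_trans; [apply Rplus_le_compat_r, Cmod_triangle|].
lra.
Qed.

(** * The Szego kernel and the moments of a positive measure *)

(** The case n = 1 is the geometric series; the general case expands the
    extremal function. *)
Lemma is_series_lacunary_geom (n : nat) (x : C) :
  (1 <= n)%nat -> Cmod x < 1 ->
  is_series (V := C_NormedModule)
    (fun k => if Nat.eqb (k mod n) 0 then x ^ k else RtoC 0)%C (/ (1 - x ^ n))%C.
Proof.
intros Hn Hx.
set (a := (fun k => if Nat.eqb (k mod n) 0 then x ^ k else RtoC 0)%C).
assert (Hb : forall k, Cmod (a k) <= Cmod x ^ k).
{ intros k; unfold a; destruct Nat.eqb; [now rewrite Cmod_pow; right|].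
  rewrite Cmod_0; apply pow_le, Cmod_ge_0. }
assert (Hex : exists l : C, is_series (V := C_NormedModule) a l).
{ apply (ex_series_le (V := C_CompleteNormedModule) a _ Hb).
  apply ex_series_geom; rewrite Rabs_pos_eq; [exact Hx | apply Cmod_ge_0]. }
destruct Hex as [l Hl].
(* Shifting the index by n multiplies the series by x^n. *)
assert (Hs : is_series (V := C_NormedModule) (fun k => a (n + k)%nat) (l - 1)%C).
{ apply (is_series_incr_n (V := C_NormedModule) a n (l - 1)%C); [lia|].
  assert (E : forall M, (M < n)%nat -> sum_n a M = RtoC 1 :> C).
  { induction M as [|M IH]; intros HM.
    - rewrite sum_O; unfold a; now rewrite Nat.Div0.mod_0_l.
    - rewrite sum_n_C_S, IH by lia; unfold a.
      rewrite Nat.mod_small by lia; simpl Nat.eqb; cbv iota; ring. }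
  rewrite E by lia; change plus with Cplus.
  replace (l - 1 + 1)%C with l by ring; exact Hl. }
assert (Hs' : is_series (V := C_NormedModule) (fun k => a (n + k)%nat) (x ^ n * l)%C).
{ apply (is_series_ext (V := C_NormedModule) (fun k => scal (x ^ n)%C (a k))).
  - intros k; change scal with Cmult; unfold a; eq_in_C.
    replace ((n + k) mod n)%nat with (k mod n)%nat.
    + destruct Nat.eqb; [now rewrite Cpow_add_r | ring].
    + replace (n + k)%nat with (k + 1 * n)%nat by lia.
      now rewrite Nat.Div0.mod_add.
  - exact (is_series_scal (V := C_NormedModule) _ _ _ Hl). }
assert (E : (l - 1)%C = (x ^ n * l)%C) by exact (Clim_unique _ _ _ Hs Hs').
assert (Hxn : (1 - x ^ n)%C <> RtoC 0).
{ intros H; assert (Hm : Cmod (x ^ n) = 1).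
  { replace (x ^ n)%C with (1 - (1 - x ^ n))%C by ring; rewrite H.
    replace (1 - 0)%C with (RtoC 1) by ring; apply Cmod_1. }
  rewrite Cmod_pow in Hm.
  assert (Cmod x ^ n < 1); [|lra].
  apply pow_lt_1_compat; [split; [apply Cmod_ge_0 | exact Hx] | lia]. }
replace (/ (1 - x ^ n))%C with l; [exact Hl|].
replace l with (l * (1 - x ^ n) * / (1 - x ^ n))%C by (field; exact Hxn).
replace (l * (1 - x ^ n))%C with (l - x ^ n * l)%C by ring.
rewrite <- E; field; exact Hxn.
Qed.

Definition kernel (z w : C) : C := (/ (1 - z * Cconj w))%C.

Lemma Cmod_kernel_arg z w : on_circle w -> Cmod (z * Cconj w) = Cmod z.
Proof. intros Hw; rewrite Cmod_mult, Cmod_conj, Hw; ring. Qed.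

Lemma one_minus_neq_0 (x : C) : Cmod x < 1 -> (1 - x)%C <> RtoC 0.
Proof.
intros Hx H; assert (Hm : Cmod x = 1); [|lra].
replace x with (1 - (1 - x))%C by ring; rewrite H.
replace (1 - 0)%C with (RtoC 1) by ring; apply Cmod_1.
Qed.

Lemma Cmod_one_minus (x : C) : 1 - Cmod x <= Cmod (1 - x).
Proof.
pose proof (Cmod_triangle (1 - x) x) as H.
replace (1 - x + x)%C with (RtoC 1) in H by ring; rewrite Cmod_1 in H; lra.
Qed.

Lemma Cmod_kernel_le z w :
  Cmod z < 1 -> on_circle w -> Cmod (kernel z w) <= / (1 - Cmod z).
Proof.
intros Hz Hw; unfold kernel.
rewrite <- (Cmod_kernel_arg z w Hw) in Hz |- *.
rewrite Cmod_inv by now apply one_minus_neq_0.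
apply Rinv_le_contravar; [lra | apply Cmod_one_minus].
Qed.

Lemma is_series_kernel z w :
  Cmod z < 1 -> on_circle w ->
  is_series (V := C_NormedModule) (fun k => (z * Cconj w) ^ k)%C (kernel z w).
Proof.
intros Hz Hw; rewrite <- (Cmod_kernel_arg z w Hw) in Hz; unfold kernel.
assert (H := is_series_lacunary_geom 1 _ (le_n 1) Hz).
rewrite Cpow_1_r in H; revert H; apply is_series_ext; intros k.
now rewrite Nat.mod_1_r.
Qed.

(** Integrating against the kernel sums the generating series of the moments:
    this is Cauchy's formula. *)
Lemma mean_kernel (F : C -> C) (B : R) (v : nat -> C) (z : C) :
  (forall w, on_circle w -> Cmod (F w) <= B) ->
  (forall k, mean (fun w => F w * Cconj w ^ k)%C (v k)) -> Cmod z < 1 ->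
  exists l, is_series (V := C_NormedModule) (fun k => z ^ k * v k)%C l /\
            mean (fun w => F w * kernel z w)%C l.
Proof.
intros HB Hv Hz.
apply (mean_series (fun k w => z ^ k * (F w * Cconj w ^ k))%C _
         (fun k => B * Cmod z ^ k)).
- intros k w Hw; rewrite !Cmod_mult, !Cmod_pow, Cmod_conj, Hw, pow1.
  rewrite Rmult_1_r, Rmult_comm.
  apply Rmult_le_compat_r; [apply pow_le, Cmod_ge_0 | now apply HB].
- apply (ex_series_scal (V := R_NormedModule) B), ex_series_geom.
  rewrite Rabs_pos_eq; [exact Hz | apply Cmod_ge_0].
- intros w Hw.
  apply (is_series_ext (V := C_NormedModule)
           (fun k => scal (F w) ((z * Cconj w) ^ k)%C)).
  + intros k; change scal with Cmult; eq_in_C; rewrite Cpow_mult_l; ring.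
  + apply (is_series_scal (V := C_NormedModule)), is_series_kernel; assumption.
- intros k; apply mean_scal, Hv.
Qed.

(** The existence of all moments of negative index is what makes products with
    kernels integrable, and it is preserved by such a product. *)
Definition has_moments (F : C -> C) : Prop :=
  (exists B, forall w, on_circle w -> Cmod (F w) <= B) /\
  forall k, exists v, mean (fun w => F w * Cconj w ^ k)%C v.

Lemma has_moments_kernel F z :
  has_moments F -> Cmod z < 1 -> has_moments (fun w => F w * kernel z w)%C.
Proof.
intros [[B HB] Hv] Hz; split.
- exists (B * / (1 - Cmod z)); intros w Hw; rewrite Cmod_mult.
  apply Rmult_le_compat; auto using Cmod_ge_0, Cmod_kernel_le.
- intros k.
  set (v := fun j => iota (T := C_CompleteNormedModule)
                       (mean (fun w => F w * Cconj w ^ j)%C)).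
  assert (Hj : forall j, mean (fun w => F w * Cconj w ^ j)%C (v j)).
  { intros j; destruct (Hv j) as [l Hl]; unfold v.
    apply (iota_correct (V := C_CompleteNormedModule)).
    exists l; split; [exact Hl | intros y Hy; now apply (mean_unique _ _ _ Hl)]. }
  destruct (mean_kernel (fun w => F w * Cconj w ^ k)%C B (fun j => v (k + j)%nat) z)
    as [l [_ Hl]]; [| |exact Hz|].
  + intros w Hw; rewrite Cmod_mult, Cmod_pow, Cmod_conj, Hw, pow1, Rmult_1_r; auto.
  + intros j; eapply mean_ext; [|apply (Hj (k + j)%nat)].
    intros w _; cbv beta; rewrite Cpow_add_r; ring.
  + exists l; eapply mean_ext; [|exact Hl]; intros w _; simpl; ring.
Qed.

(** Functions whose Fourier coefficients of positive index vanish: boundary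
    values of antianalytic functions, with value c at the origin. *)
Definition antianalytic (F : C -> C) (c : C) : Prop :=
  (exists B, forall w, on_circle w -> Cmod (F w) <= B) /\
  mean F c /\ forall k, mean (fun w => F w * Cconj w ^ S k)%C 0.

(** The kernel is antianalytic in w with value 1 at the origin. *)
Lemma antianalytic_kernel F c z :
  antianalytic F c -> Cmod z < 1 ->
  antianalytic (fun w => F w * kernel z w)%C c.
Proof.
intros [[B HB] [H0 HS]] Hz.
(* Only the moment of index 0 survives in the generating series. *)
assert (Hser : forall v : nat -> C, (forall k, v (S k) = RtoC 0) -> forall l,
  is_series (V := C_NormedModule) (fun k => z ^ k * v k)%C l -> l = v 0%nat).
{ intros v Hv l Hl.
  apply (Clim_unique (sum_n (fun k => z ^ k * v k)%C)); [exact Hl|].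
  apply Clim_ext with (fun _ => v 0%nat); [|apply filterlim_const].
  induction N as [|N IH]; [rewrite sum_O; simpl; ring|].
  rewrite sum_n_C_S, <- IH, Hv; ring. }
assert (Hk : forall k, mean (fun w => F w * Cconj w ^ k)%C
                         (match k with O => c | S _ => RtoC 0 end)).
{ intros [|k]; [|apply HS].
  eapply mean_ext; [|exact H0]; intros w _; simpl; ring. }
assert (Hmain : forall k, mean (fun w => F w * kernel z w * Cconj w ^ k)%C
                         (match k with O => c | S _ => RtoC 0 end)).
{ intros k.
  destruct (mean_kernel (fun w => F w * Cconj w ^ k)%C B
     (fun j => match (k + j)%nat with O => c | S _ => RtoC 0 end) z)
    as [l [Hl1 Hl2]]; [| |exact Hz|].
  - intros w Hw; rewrite Cmod_mult, Cmod_pow, Cmod_conj, Hw, pow1, Rmult_1_r; auto.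
  - intros j; eapply mean_ext; [|apply (Hk (k + j)%nat)].
    intros w _; cbv beta; rewrite Cpow_add_r; ring.
  - apply Hser in Hl1; [|intros j; now rewrite Nat.add_succ_r].
    rewrite Nat.add_0_r in Hl1; rewrite <- Hl1.
    eapply mean_ext; [|exact Hl2]; intros w _; simpl; ring. }
split; [|split].
- exists (B * / (1 - Cmod z)); intros w Hw; rewrite Cmod_mult.
  apply Rmult_le_compat; auto using Cmod_ge_0, Cmod_kernel_le.
- eapply mean_ext; [|apply (Hmain 0%nat)]; intros w _; simpl; ring.
- intros k; exact (Hmain (S k)).
Qed.

(** * The Schwarz-Pick inequality for the moments of a positive weight *)

Definition wmean (u : C -> R) (g : C -> C) (v : C) : Prop :=
  mean (fun w => RtoC (u w) * g w)%C v.

Lemma wmean_ext u g h v :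
  (forall w, on_circle w -> g w = h w) -> wmean u g v -> wmean u h v.
Proof. intros H; apply mean_ext; intros w Hw; now rewrite H. Qed.

Lemma wmean_plus u g h v v' :
  wmean u g v -> wmean u h v' -> wmean u (fun w => g w + h w)%C (v + v')%C.
Proof.
intros Hg Hh; eapply mean_ext; [|exact (mean_plus _ _ _ _ Hg Hh)].
intros w _; simpl; ring.
Qed.

Lemma wmean_scal u c g v : wmean u g v -> wmean u (fun w => c * g w)%C (c * v)%C.
Proof.
intros Hg; eapply mean_ext; [|exact (mean_scal c _ _ Hg)].
intros w _; simpl; ring.
Qed.

Lemma wmean_conj u g v :
  wmean u g v -> wmean u (fun w => Cconj (g w)) (Cconj v).
Proof.
intros Hg; eapply mean_ext; [|exact (mean_conj _ _ Hg)].
intros w _; simpl; now rewrite Cmult_conj, Cconj_RtoC.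
Qed.

Lemma wmean_sum u (g : nat -> C -> C) (v : nat -> C) N :
  (forall k, (k <= N)%nat -> wmean u (g k) (v k)) ->
  wmean u (fun w => sum_n (fun k => g k w) N) (sum_n v N).
Proof.
intros H; eapply mean_ext; [|exact (mean_sum _ _ _ H)].
intros w _; simpl; apply sum_n_C_scal.
Qed.

Lemma Cmod_wmean_le u g h v v' :
  (forall w, on_circle w -> 0 <= u w) ->
  (forall w, on_circle w -> Cmod (g w) <= Re (h w)) ->
  wmean u g v -> wmean u h v' -> Cmod v <= Re v'.
Proof.
intros Hu H Hg Hh; refine (Cmod_mean_le _ _ _ _ _ Hg Hh).
intros w Hw; rewrite Cmod_mult, re_scal_l, Cmod_R, Rabs_pos_eq by auto.
apply Rmult_le_compat_l; auto.
Qed.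

Section Schwarz_Pick.

Variables (u : C -> R) (z : C) (N : nat) (m s : C).
Hypothesis Hu : forall w, on_circle w -> 0 <= u w.
Hypothesis Hz : Cmod z < 1.
Hypothesis Hone : wmean u (fun _ => RtoC 1) 1.
Hypothesis Hpow : forall k, (1 <= k <= N)%nat -> wmean u (fun w => Cconj w ^ k)%C 0.
Hypothesis Hker : wmean u (kernel z) m.
Hypothesis Hker2 : wmean u (fun w => kernel z w * kernel z w)%C s.

(* On the circle, a has modulus |z| and the kernel is the sum of the powers of
   a; the products of powers of a and b = conj a reduce to powers of one of
   them, up to a power of |z|^2. *)
Let r2 : C := RtoC (Cmod z ^ 2).
Let a (w : C) : C := (z * Cconj w)%C.
Let b (w : C) : C := Cconj (a w).
Let sigma (w : C) : C := sum_n (fun j => a w ^ j)%C N.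
Let psi (w : C) : C := (kernel z w - m * sigma w)%C.

Lemma ab_circle w : on_circle w -> (b w * a w)%C = r2.
Proof.
intros Hw; unfold r2, b; rewrite Cmult_comm, <- Cmod2_conj; unfold a.
now rewrite Cmod_kernel_arg.
Qed.

Lemma kernel_step w : on_circle w -> kernel z w = (1 + a w * kernel z w)%C.
Proof.
intros Hw; unfold kernel, a; field; apply one_minus_neq_0.
now rewrite Cmod_kernel_arg.
Qed.

Lemma wmean_a_pow k : (1 <= k <= N)%nat -> wmean u (fun w => a w ^ k)%C 0.
Proof.
intros Hk; replace (RtoC 0) with (z ^ k * 0)%C by ring.
eapply wmean_ext; [|apply wmean_scal, (Hpow k Hk)].
intros w _; unfold a; simpl; now rewrite Cpow_mult_l.
Qed.

Lemma wmean_b_pow k : (1 <= k <= N)%nat -> wmean u (fun w => b w ^ k)%C 0.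
Proof.
intros Hk; replace (RtoC 0) with (Cconj 0) by apply Cconj_RtoC.
eapply wmean_ext; [|apply wmean_conj, (wmean_a_pow k Hk)].
intros w _; unfold b; simpl; now rewrite Cpow_conj.
Qed.

(** Both recursions below come from b * kernel = b + |z|^2 * kernel and the
    vanishing of the mean of the powers of b. *)
Lemma wmean_b_kernel k :
  (k <= N)%nat -> wmean u (fun w => b w ^ k * kernel z w)%C (r2 ^ k * m)%C.
Proof.
induction k as [|k IH]; intros Hk.
- replace (r2 ^ 0 * m)%C with m by (simpl; ring).
  eapply wmean_ext; [|exact Hker]; intros w _; simpl; ring.
- replace (r2 ^ S k * m)%C with (0 + r2 * (r2 ^ k * m))%C by (simpl; ring).
  eapply wmean_ext;
    [|apply wmean_plus; [apply (wmean_b_pow (S k)); lia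
                        |apply wmean_scal, IH; lia]].
  intros w Hw; cbv beta; rewrite (kernel_step w Hw) at 2; rewrite <- (ab_circle w Hw).
  rewrite Cpow_S; ring.
Qed.

Lemma wmean_b_kernel2 k :
  (k <= N)%nat -> wmean u (fun w => b w ^ k * (kernel z w * kernel z w))%C
                    (r2 ^ k * (s + INR k * m))%C.
Proof.
induction k as [|k IH]; intros Hk.
- replace (r2 ^ 0 * (s + INR 0 * m))%C with s by (simpl; ring).
  eapply wmean_ext; [|exact Hker2]; intros w _; simpl; ring.
- replace (r2 ^ S k * (s + INR (S k) * m))%C
    with (r2 ^ S k * m + r2 * (r2 ^ k * (s + INR k * m)))%C
    by (rewrite S_INR, RtoC_plus; simpl; ring).
  eapply wmean_ext;
    [|apply wmean_plus; [apply (wmean_b_kernel (S k)); lia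
                        |apply wmean_scal, IH; lia]].
  intros w Hw; cbv beta; rewrite (kernel_step w Hw) at 4; rewrite <- (ab_circle w Hw).
  rewrite Cpow_S; ring.
Qed.

Lemma wmean_b_sigma k :
  (k <= N)%nat -> wmean u (fun w => b w ^ k * sigma w)%C (r2 ^ k)%C.
Proof.
induction k as [|k IH]; intros Hk.
- apply wmean_ext with sigma; [intros w _; simpl; ring|].
  replace (r2 ^ 0)%C with (sum_n (fun j => match j with O => RtoC 1 | _ => RtoC 0 end) N).
  + apply (wmean_sum u (fun j w => a w ^ j)%C); intros [|j] Hj.
    * exact Hone.
    * apply wmean_a_pow; lia.
  + clear; induction N as [|M IH]; [now rewrite sum_O|].
    rewrite sum_n_C_S, IH; simpl; ring.
- destruct (Nat.le_exists_sub (S k) N Hk) as [p [Hp _]].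
  replace (r2 ^ S k)%C with (0 + (r2 * (r2 ^ k) + (- r2 ^ S k) * 0))%C by (simpl; ring).
  (* b * sigma = b + |z|^2 * (sigma - a^N), and b^k * a^N is a power of a. *)
  eapply wmean_ext;
    [|apply wmean_plus; [apply (wmean_b_pow (S k)); lia
                        |apply wmean_plus;
                          [apply wmean_scal, IH; lia
                          |apply wmean_scal, (wmean_a_pow (S p)); lia]]].
  intros w Hw; cbv beta; rewrite <- (ab_circle w Hw).
  assert (Es : sigma w = (1 + a w * sigma w - a w ^ S N)%C).
  { unfold sigma; clear; induction N as [|M IH]; [rewrite sum_O; simpl; ring|].
    rewrite !sum_n_C_S, (Cpow_S _ (S M)), IH at 1; ring. }
  rewrite Es at 2.
  replace (a w ^ S N)%C with (a w ^ S k * (a w ^ S p))%C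
    by (rewrite <- Cpow_add_r; f_equal; lia).
  rewrite Cpow_mult_l, (Cpow_S (b w)); ring.
Qed.

(** The vector psi is the component of the kernel orthogonal to the span of the
    powers of a of exponent at most N, which form an orthogonal family because
    the moments of index 1 to N vanish. *)
Lemma wmean_b_psi k : (k <= N)%nat -> wmean u (fun w => b w ^ k * psi w)%C 0.
Proof.
intros Hk; replace (RtoC 0) with (r2 ^ k * m + (- m) * r2 ^ k)%C by ring.
eapply wmean_ext;
  [|apply wmean_plus; [apply (wmean_b_kernel k Hk)
                      |apply wmean_scal, (wmean_b_sigma k Hk)]].
intros w _; unfold psi; simpl; ring.
Qed.

Lemma conj_sigma w : Cconj (sigma w) = sum_n (fun k => b w ^ k)%C N.
Proof.
unfold sigma; rewrite sum_n_C_conj; apply sum_n_C_ext_loc; intros k _.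
now rewrite Cpow_conj.
Qed.

Lemma sum_n_C_scal_r (x : nat -> C) (c : C) M :
  sum_n (fun k => (x k * c)%C) M = (sum_n x M * c)%C.
Proof. exact (sum_n_mult_r (K := C_Ring) c x M). Qed.

Lemma wmean_conj_sigma_psi : wmean u (fun w => Cconj (sigma w) * psi w)%C 0.
Proof.
replace (RtoC 0) with (sum_n (fun _ : nat => RtoC 0) N)
  by (rewrite sum_n_C_const; eq_in_C; ring).
eapply wmean_ext; [|apply (wmean_sum u (fun k w => b w ^ k * psi w)%C)].
- intros w _; simpl; rewrite conj_sigma; apply sum_n_C_scal_r.
- intros k Hk; apply (wmean_b_psi k Hk).
Qed.

Lemma wmean_b_sigma_psi : wmean u (fun w => b w ^ N * sigma w * psi w)%C 0.
Proof.
replace (RtoC 0) with (sum_n (fun _ : nat => RtoC 0) N)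
  by (rewrite sum_n_C_const; eq_in_C; ring).
eapply wmean_ext; [|apply (wmean_sum u (fun k w => r2 ^ k * (b w ^ (N - k) * psi w))%C)].
- intros w Hw; cbv beta.
  transitivity (sum_n (fun k => b w ^ N * a w ^ k * psi w)%C N).
  + apply sum_n_C_ext_loc; intros k Hk.
    replace (b w ^ N)%C with (b w ^ k * b w ^ (N - k))%C
      by (rewrite <- Cpow_add_r; f_equal; lia).
    rewrite <- (ab_circle w Hw), Cpow_mult_l; ring.
  + unfold sigma; rewrite <- sum_n_C_scal, <- sum_n_C_scal_r; reflexivity.
- intros k Hk; replace (RtoC 0) with (r2 ^ k * 0)%C by ring.
  apply wmean_scal, wmean_b_psi; lia.
Qed.

Let S2 : R := sum_n (fun k => (Cmod z ^ 2) ^ k) N.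

Lemma sum_n_RtoC (x : nat -> R) M :
  sum_n (fun k => RtoC (x k)) M = RtoC (sum_n x M) :> C.
Proof.
induction M as [|M IH]; [now rewrite !sum_O|].
rewrite sum_n_C_S, IH, sum_Sn; change plus with Rplus; now rewrite RtoC_plus.
Qed.

Lemma wmean_sigma_kernel :
  wmean u (fun w => sigma w * Cconj (kernel z w))%C (Cconj m * S2)%C.
Proof.
replace (Cconj m * S2)%C with (Cconj (S2 * m)) by
  (rewrite Cmult_conj, Cconj_RtoC; ring).
apply wmean_ext with (fun w => Cconj (Cconj (sigma w) * kernel z w)).
{ intros w _; now rewrite Cmult_conj, Cconj_conj. }
apply wmean_conj.
replace (S2 * m)%C with (sum_n (fun k => r2 ^ k * m)%C N).
- eapply wmean_ext; [|apply (wmean_sum u (fun k w => b w ^ k * kernel z w)%C)].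
  + intros w _; cbv beta; rewrite conj_sigma; apply sum_n_C_scal_r.
  + intros k Hk; apply (wmean_b_kernel k Hk).
- rewrite sum_n_C_scal_r; f_equal; unfold S2, r2; rewrite <- sum_n_RtoC.
  apply sum_n_C_ext_loc; intros k _; symmetry; apply RtoC_pow.
Qed.

(** On the circle (1 - |z|^2) |kernel|^2 = 2 Re kernel - 1, the Poisson kernel. *)
Lemma wmean_kernel_norm :
  wmean u (fun w => kernel z w * Cconj (kernel z w))%C
    (RtoC ((2 * Re m - 1) / (1 - Cmod z ^ 2))).
Proof.
assert (Hr : 1 - Cmod z ^ 2 <> 0) by (apply Rgt_not_eq; pose proof (Cmod_ge_0 z); nra).
replace (RtoC ((2 * Re m - 1) / (1 - Cmod z ^ 2)))
  with (RtoC (/ (1 - Cmod z ^ 2)) * (m + Cconj m + (- (1)) * 1))%C.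
2:{ unfold Rdiv; set (t := / (1 - Cmod z ^ 2)).
    apply injective_projections; simpl; unfold Re; ring. }
eapply wmean_ext;
  [|apply wmean_scal, wmean_plus;
    [apply wmean_plus; [exact Hker | exact (wmean_conj _ _ _ Hker)]
    |apply wmean_scal, Hone]].
intros w Hw; cbv beta.
assert (Ha : (1 - a w)%C <> RtoC 0)
  by (apply one_minus_neq_0; unfold a; now rewrite Cmod_kernel_arg).
assert (Hb : (1 - b w)%C <> RtoC 0)
  by (apply one_minus_neq_0; unfold b, a; now rewrite Cmod_conj, Cmod_kernel_arg).
replace (Cconj (kernel z w)) with (/ (1 - b w))%C.
2:{ unfold kernel; fold (a w); rewrite Cinv_conj, Cminus_conj, Cconj_RtoC; auto. }
unfold kernel; fold (a w).
rewrite RtoC_inv, RtoC_minus by exact Hr; fold r2.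
assert (Hr' : (1 - r2)%C <> RtoC 0).
{ unfold r2; rewrite <- RtoC_minus; intros H; apply RtoC_inj in H; auto. }
rewrite <- (ab_circle w Hw) in Hr' |- *.
field; auto.
Qed.

Lemma wmean_psi_norm :
  wmean u (fun w => psi w * Cconj (psi w))%C
    (RtoC ((2 * Re m - 1) / (1 - Cmod z ^ 2) - Cmod m ^ 2 * S2)).
Proof.
replace (RtoC ((2 * Re m - 1) / (1 - Cmod z ^ 2) - Cmod m ^ 2 * S2)) with
  (RtoC ((2 * Re m - 1) / (1 - Cmod z ^ 2)) + (- m) * (Cconj m * S2) +
   (- Cconj m) * 0)%C
  by (rewrite RtoC_minus, RtoC_mult, Cmod2_conj; ring).
eapply wmean_ext;
  [|apply wmean_plus;
    [apply wmean_plus; [apply wmean_kernel_norm | apply wmean_scal, wmean_sigma_kernel]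
    |apply wmean_scal, wmean_conj_sigma_psi]].
intros w _; cbv beta; unfold psi; rewrite Cminus_conj, Cmult_conj; ring.
Qed.

(** Orthogonality removes the terms with sigma * psi; the rest is computed from
    b^N * a^k = |z|^(2k) * b^(N-k). *)
Lemma wmean_b_psi2 :
  wmean u (fun w => b w ^ N * (psi w * psi w))%C
    (r2 ^ N * (s + INR N * m - INR (S N) * (m * m)))%C.
Proof.
assert (H : wmean u (fun w => b w ^ N * sigma w * kernel z w)%C
              (INR (S N) * (r2 ^ N * m))%C).
{ replace (INR (S N) * (r2 ^ N * m))%C
    with (0 + m * (INR (S N) * r2 ^ N))%C by ring.
  eapply wmean_ext;
    [|apply wmean_plus; [apply wmean_b_sigma_psi|apply wmean_scal]].
  - instantiate (1 := fun w => (b w ^ N * sigma w * sigma w)%C).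
    intros w _; unfold psi; simpl; ring.
  - replace (INR (S N) * r2 ^ N)%C with (sum_n (fun _ : nat => r2 ^ N)%C N).
    2:{ apply sum_n_C_const. }
    eapply wmean_ext;
      [|apply (wmean_sum u (fun k w => r2 ^ k * (b w ^ (N - k) * sigma w))%C)].
    + intros w Hw; cbv beta.
      transitivity (sum_n (fun k => b w ^ N * a w ^ k * sigma w)%C N).
      * apply sum_n_C_ext_loc; intros k Hk.
        replace (b w ^ N)%C with (b w ^ k * b w ^ (N - k))%C
          by (rewrite <- Cpow_add_r; f_equal; lia).
        rewrite <- (ab_circle w Hw), Cpow_mult_l; ring.
      * rewrite sum_n_C_scal_r, sum_n_C_scal; reflexivity.
    + intros k Hk.
      replace (r2 ^ N)%C with (r2 ^ k * r2 ^ (N - k))%C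
        by (rewrite <- Cpow_add_r; f_equal; lia).
      apply wmean_scal, wmean_b_sigma; lia. }
replace (r2 ^ N * (s + INR N * m - INR (S N) * (m * m)))%C
  with (r2 ^ N * (s + INR N * m) + (- m) * (INR (S N) * (r2 ^ N * m)) + (- m) * 0)%C
  by ring.
eapply wmean_ext;
  [|apply wmean_plus;
    [apply wmean_plus; [apply (wmean_b_kernel2 N (le_n N)) | apply wmean_scal, H]
    |apply wmean_scal, wmean_b_sigma_psi]].
intros w _; cbv beta; unfold psi; ring.
Qed.

(** On the circle b^N psi^2 and |psi|^2 agree in modulus up to the factor
    |z|^N, so the triangle inequality compares their integrals. *)
Lemma schwarz_pick_moments :
  0 < Cmod z ->
  Cmod z ^ N * Cmod (s + INR N * m - INR (S N) * (m * m)) <=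
  (2 * Re m - 1) / (1 - Cmod z ^ 2) - Cmod m ^ 2 * S2.
Proof.
intros Hz0.
set (T := (s + INR N * m - INR (S N) * (m * m))%C).
set (Y := (2 * Re m - 1) / (1 - Cmod z ^ 2) - Cmod m ^ 2 * S2).
assert (HN : 0 < Cmod z ^ N) by now apply pow_lt.
apply Rmult_le_reg_l with (1 := HN).
replace (Cmod z ^ N * (Cmod z ^ N * Cmod T)) with (Cmod (r2 ^ N * T)).
2:{ unfold r2; rewrite Cmod_mult, Cmod_pow, Cmod_R, Rabs_pos_eq by apply pow2_ge_0.
    replace (Cmod z ^ 2) with (Cmod z * Cmod z) by ring.
    rewrite Rpow_mult_distr; ring. }
replace (Cmod z ^ N * Y) with (Re (RtoC (Cmod z ^ N) * RtoC Y))
  by (rewrite re_scal_l, re_RtoC; reflexivity).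
refine (Cmod_wmean_le u _ _ _ _ Hu _ wmean_b_psi2 (wmean_scal _ _ _ _ wmean_psi_norm)).
intros w Hw; cbv beta.
rewrite re_scal_l, <- Cmod2_conj, re_RtoC, !Cmod_mult, Cmod_pow.
unfold b, a; rewrite Cmod_conj, Cmod_kernel_arg by exact Hw.
right; ring.
Qed.

End Schwarz_Pick.

(** * Complex derivatives *)

Notation is_C_derive f z l :=
  (is_derive (K := C_AbsRing) (V := C_NormedModule) (f : C -> C) (z : C) (l : C)).

Lemma is_C_derive_const (c z : C) : is_C_derive (fun _ => c) z (RtoC 0).
Proof. exact (is_derive_const (K := C_AbsRing) (V := C_NormedModule) c z). Qed.

(** C carries two normed module structures over itself, with the same norm but
    different uniform structures; the product rule is available for one of them,
    the limit of difference quotients for the other. *)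
Lemma is_C_derive_AbsRing (f : C -> C) (z l : C) :
  is_derive (K := C_AbsRing) (V := AbsRing_NormedModule C_AbsRing) f z l <->
  is_C_derive f z l.
Proof.
split; intros [_ H]; (split; [apply is_linear_scal_l|]);
  intros x Hx eps; exact (H x Hx eps).
Qed.

Lemma is_C_derive_id (z : C) : is_C_derive (fun x => x) z (RtoC 1).
Proof. apply is_C_derive_AbsRing; exact (is_derive_id (K := C_AbsRing) z). Qed.

Lemma is_C_derive_plus (f g : C -> C) (z df dg : C) :
  is_C_derive f z df -> is_C_derive g z dg ->
  is_C_derive (fun x => f x + g x)%C z (df + dg)%C.
Proof. exact (is_derive_plus (K := C_AbsRing) (V := C_NormedModule) f g z df dg). Qed.

Lemma is_C_derive_mult (f g : C -> C) (z df dg : C) :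
  is_C_derive f z df -> is_C_derive g z dg ->
  is_C_derive (fun x => f x * g x)%C z (df * g z + f z * dg)%C.
Proof.
rewrite <- !is_C_derive_AbsRing; intros Hf Hg.
exact (is_derive_mult (K := C_AbsRing) f g z df dg Hf Hg Cmult_comm).
Qed.

Lemma is_C_derive_comp (f g : C -> C) (z df dg : C) :
  is_C_derive f (g z) df -> is_C_derive g z dg ->
  is_C_derive (fun x => f (g x)) z (dg * df)%C.
Proof.
intros Hf Hg; apply (is_derive_comp (K := C_AbsRing) (V := C_NormedModule) f g z df dg).
- exact Hf.
- now apply is_C_derive_AbsRing.
Qed.

Lemma is_C_derive_pow (z : C) (n : nat) :
  is_C_derive (fun x => x ^ S n)%C z (INR (S n) * z ^ n)%C.
Proof.
induction n as [|n IH].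
- replace (INR 1 * z ^ 0)%C with (RtoC 1) by (simpl; ring).
  apply (is_derive_ext (K := C_AbsRing) (V := C_NormedModule) (fun x => x)).
  + intros x; exact (eq_sym (Cpow_1_r x)).
  + apply is_C_derive_id.
- replace (INR (S (S n)) * z ^ S n)%C with (1 * z ^ S n + z * (INR (S n) * z ^ n))%C
    by (rewrite (S_INR (S n)), RtoC_plus; simpl; ring).
  exact (is_C_derive_mult (fun x => x) (fun x => x ^ S n)%C z _ _ (is_C_derive_id z) IH).
Qed.

(** The form in which the inverse and the Cauchy integrals are differentiated. *)
Lemma is_C_derive_quadratic (f : C -> C) (z l : C) (delta K : R) :
  0 < delta ->
  (forall h, Cmod h < delta ->
     Cmod (f (z + h)%C - f z - h * l) <= K * Cmod h ^ 2) ->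
  is_C_derive f z l.
Proof.
intros Hd H; split.
{ apply (is_linear_scal_l (K := C_AbsRing) (V := C_NormedModule)). }
intros x Hx.
apply (is_filter_lim_locally_unique (K := C_AbsRing) (V := AbsRing_NormedModule C_AbsRing)) in Hx; subst x.
intros eps.
set (K' := Rabs K + 1).
assert (HK' : 0 < K') by (unfold K'; pose proof (Rabs_pos K); lra).
assert (Hr : 0 < Rmin delta (eps / K')).
{ apply Rmin_glb_lt; [exact Hd | apply Rdiv_lt_0_compat; [apply cond_pos | exact HK']]. }
apply (locally_le_locally_norm (V := AbsRing_NormedModule C_AbsRing)).
exists (mkposreal _ Hr); intros y Hy.
change (Cmod (y - z) < Rmin delta (eps / K')) in Hy.
change (Cmod (f y - f z - (y - z) * l) <= eps * Cmod (y - z)).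
assert (H1 : Cmod (y - z) < delta) by (eapply Rlt_le_trans; [exact Hy | apply Rmin_l]).
assert (H2 : Cmod (y - z) < eps / K') by (eapply Rlt_le_trans; [exact Hy | apply Rmin_r]).
specialize (H (y - z)%C H1).
assert (E : forall x w : C, (x + (w - x))%C = w) by (intros; ring).
rewrite E in H.
apply Rlt_div_r in H2; [|exact HK'].
pose proof (Cmod_ge_0 (y - z)); pose proof (Rle_abs K); unfold K' in *; nra.
Qed.

Lemma is_C_derive_Cinv (z : C) :
  z <> RtoC 0 ->
  is_C_derive Cinv z (- / (z * z))%C.
Proof.
intros Hz; assert (Hm : 0 < Cmod z) by now apply Cmod_gt_0.
apply is_C_derive_quadratic with (delta := Cmod z / 2) (K := 2 / Cmod z ^ 3); [lra|].
intros h Hh.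
assert (Hzh : Cmod z / 2 <= Cmod (z + h)).
{ pose proof (Cmod_triangle (z + h) (- h)) as Ht; rewrite Cmod_opp in Ht.
  replace (z + h + - h)%C with z in Ht by ring; lra. }
assert (Hzh0 : (z + h)%C <> RtoC 0) by (apply Cmod_gt_0; lra).
replace (/ (z + h) - / z - h * - / (z * z))%C with (h ^ 2 / (z ^ 2 * (z + h)))%C
  by (field; auto).
rewrite Cmod_div, Cmod_mult, !Cmod_pow
  by (apply Cmult_neq_0; [now apply Cpow_nz | exact Hzh0]).
unfold Rdiv; rewrite Rmult_comm.
apply Rmult_le_compat_r; [apply pow_le, Cmod_ge_0|].
replace (2 * / Cmod z ^ 3) with (/ (Cmod z ^ 2 * (Cmod z / 2))) by (field; lra).
assert (0 < Cmod z ^ 2) by now apply pow_lt.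
apply Rinv_le_contravar; [nra|]; apply Rmult_le_compat_l; lra.
Qed.

(** * The logarithmic derivative of a function with positive real part *)

Lemma circle_conj w : on_circle w -> (w * Cconj w)%C = RtoC 1.
Proof. intros Hw; rewrite <- Cmod2_conj, Hw; f_equal; ring. Qed.

Lemma mean_monomial l k :
  mean (fun w => w ^ l * Cconj w ^ k)%C (if Nat.eqb l k then 1 else 0).
Proof.
assert (Ec : forall w j, on_circle w -> (w ^ j * Cconj w ^ j)%C = RtoC 1).
{ intros w j Hw; now rewrite <- Cpow_mult_l, circle_conj, Cpow_1_l. }
destruct (Nat.eqb_spec l k) as [->|Hlk].
- eapply mean_ext; [|exact mean_1]; intros w Hw; now rewrite Ec.
- destruct (Nat.lt_ge_cases k l) as [Hl|Hl].
  + destruct (Nat.le_exists_sub (S k) l Hl) as [p [-> _]].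
    eapply mean_ext; [|apply (mean_pow p)]; intros w Hw; cbv beta.
    replace (p + S k)%nat with (S p + k)%nat by lia.
    rewrite Cpow_add_r, <- Cmult_assoc, Ec by exact Hw; ring.
  + destruct (Nat.le_exists_sub (S l) k) as [p [-> _]]; [lia|].
    replace (RtoC 0) with (Cconj 0) by apply Cconj_RtoC.
    eapply mean_ext; [|apply mean_conj, (mean_pow p)]; intros w Hw; cbv beta.
    replace (p + S l)%nat with (l + S p)%nat by lia.
    rewrite Cpow_add_r, Cmult_assoc, Ec, Cpow_conj by exact Hw; ring.
Qed.

Lemma is_series_single (d : nat -> C) k :
  is_series (V := C_NormedModule) (fun l => if Nat.eqb l k then d l else RtoC 0) (d k).
Proof.
apply Clim_iff; intros eps; exists k; intros N HN.
change (Cmod (sum_n (fun l => if Nat.eqb l k then d l else RtoC 0) N - d k) < eps).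
replace (sum_n (fun l => if Nat.eqb l k then d l else RtoC 0) N : C) with (d k).
{ replace (d k - d k)%C with (RtoC 0) by ring; rewrite Cmod_0; apply cond_pos. }
assert (E : forall M, sum_n (fun l => if Nat.eqb l k then d l else RtoC 0) M =
  (if Nat.leb k M then d k else RtoC 0) :> C).
{ induction M as [|M IH].
  - rewrite sum_O; destruct k; reflexivity.
  - rewrite sum_n_C_S, IH.
    destruct (Nat.eqb_spec (S M) k) as [<-|Hne].
    + rewrite (proj2 (Nat.leb_gt (S M) M)), Nat.leb_refl by lia; ring.
    + destruct (Nat.leb_spec k M), (Nat.leb_spec k (S M)); try lia; ring. }
rewrite E, (proj2 (Nat.leb_le k N)) by exact HN; reflexivity.
Qed.

Section Power_series.

Variables (d : nat -> C) (q : C -> C).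
Hypothesis Hd : ex_series (fun k => Cmod (d k)).
Hypothesis Hq : forall z, Cmod z <= 1 ->
  is_series (V := C_NormedModule) (fun k => z ^ k * d k)%C (q z).

Lemma power_series_moment k : mean (fun w => q w * Cconj w ^ k)%C (d k).
Proof.
destruct (mean_series (fun l w => d l * (w ^ l * Cconj w ^ k))%C
            (fun w => q w * Cconj w ^ k)%C (fun l => Cmod (d l))
            (fun l => if Nat.eqb l k then d l else RtoC 0)) as [l [Hl1 Hl2]].
- intros l w Hw; rewrite !Cmod_mult, !Cmod_pow, Cmod_conj, Hw, !pow1; lra.
- exact Hd.
- intros w Hw.
  apply (is_series_ext (V := C_NormedModule)
           (fun l => scal (Cconj w ^ k)%C (w ^ l * d l)%C)).
  { intros l; change scal with Cmult; eq_in_C; ring. }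
  replace (q w * Cconj w ^ k)%C with (scal (Cconj w ^ k)%C (q w))
    by (change scal with Cmult; eq_in_C; ring).
  apply (is_series_scal (V := C_NormedModule)), Hq; right; exact Hw.
- intros l.
  replace (if Nat.eqb l k then d l else RtoC 0)
    with (d l * (if Nat.eqb l k then 1 else 0))%C by (destruct Nat.eqb; ring).
  apply mean_scal, mean_monomial.
- now rewrite (Clim_unique _ _ _ (is_series_single d k) Hl1).
Qed.

Lemma power_series_bounded : exists B, forall w, on_circle w -> Cmod (q w) <= B.
Proof.
destruct Hd as [B HB]; exists B; intros w Hw.
assert (HB' : is_lim_seq (sum_n (fun k => Cmod (d k))) B) by exact HB.
refine (is_lim_seq_le _ _ (Cmod (q w)) B _ (Clim_Cmod _ _ (Hq w (Req_le _ _ Hw))) HB').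
induction n as [|N IH].
- rewrite !sum_O, Cmod_mult, Cmod_pow, Hw; simpl; lra.
- rewrite sum_n_C_S, sum_Sn; change plus with Rplus.
  eapply Rle_trans; [apply Cmod_triangle|]; apply Rplus_le_compat; [exact IH|].
  rewrite Cmod_mult, Cmod_pow, Hw, pow1; lra.
Qed.

Lemma power_series_has_moments : has_moments q.
Proof.
split; [exact power_series_bounded|]; intros k; exists (d k).
apply power_series_moment.
Qed.

(** The moments of conj q are the conjugates of the integrals of q(w) w^k,
    whose power series have no constant term when k > 0. *)
Lemma power_series_conj_antianalytic :
  antianalytic (fun w => Cconj (q w)) (Cconj (d 0%nat)).
Proof.
split; [|split].
- destruct power_series_bounded as [B HB]; exists B; intros w Hw.
  rewrite Cmod_conj; now apply HB.
- apply mean_conj; eapply mean_ext; [|apply (power_series_moment 0)].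
  intros w _; simpl; ring.
- intros k; rewrite <- (Cconj_RtoC 0).
  apply mean_ext with (fun w => Cconj (q w * w ^ S k)%C).
  { intros w _; now rewrite Cmult_conj, Cpow_conj. }
  apply mean_conj.
  destruct (mean_series (fun l w => d l * w ^ S (l + k))%C
              (fun w => q w * w ^ S k)%C (fun l => Cmod (d l))
              (fun _ => RtoC 0)) as [l [Hl1 Hl2]].
  + intros l w Hw; rewrite Cmod_mult, Cmod_pow, Hw, pow1; lra.
  + exact Hd.
  + intros w Hw.
    apply (is_series_ext (V := C_NormedModule)
             (fun l => scal (w ^ S k)%C (w ^ l * d l)%C)).
    { intros l; change scal with Cmult; eq_in_C.
      replace (S (l + k)) with (l + S k)%nat by lia; rewrite Cpow_add_r; ring. }
    replace (q w * w ^ S k)%C with (scal (w ^ S k)%C (q w))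
      by (change scal with Cmult; eq_in_C; ring).
    apply (is_series_scal (V := C_NormedModule)), Hq; right; exact Hw.
  + intros l; replace (RtoC 0) with (d l * 0)%C by ring; apply mean_scal, mean_pow.
  + replace (RtoC 0) with l; [exact Hl2|].
    apply (Clim_unique _ _ _ Hl1).
    apply Clim_ext with (fun _ => RtoC 0); [|apply filterlim_const].
    intros N; rewrite sum_n_C_const; ring.
Qed.

Lemma cauchy_formula z : Cmod z < 1 -> mean (fun w => q w * kernel z w)%C (q z).
Proof.
intros Hz; destruct power_series_bounded as [B HB].
destruct (mean_kernel q B d z HB power_series_moment Hz) as [l [Hl1 Hl2]].
now rewrite (Clim_unique _ _ _ (Hq z (Rlt_le _ _ Hz)) Hl1).
Qed.

(** Cauchy's formula for the derivative: the second order remainder of the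
    kernel in its first variable is a product of kernels, hence quadratic in the
    increment. *)
Lemma cauchy_formula_derive z D :
  Cmod z < 1 ->
  mean (fun w => q w * (Cconj w * (kernel z w * kernel z w)))%C D ->
  is_C_derive q z D.
Proof.
intros Hz HD; destruct power_series_bounded as [B HB].
set (e := (1 - Cmod z) / 2).
apply is_C_derive_quadratic with (delta := e)
  (K := B * (/ e * (/ (1 - Cmod z) * / (1 - Cmod z)))); [unfold e; lra|].
intros h Hh.
assert (Hzh : Cmod (z + h) <= 1 - e)
  by (pose proof (Cmod_triangle z h); unfold e in *; lra).
assert (Hzh1 : Cmod (z + h) < 1) by (unfold e in *; lra).
assert (Hm : mean (fun w => q w * (h ^ 2 * (Cconj w ^ 2 *
               (kernel (z + h) w * (kernel z w * kernel z w)))))%C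
               (q (z + h)%C + (- (1)) * q z + (- h) * D)%C).
{ eapply mean_ext;
    [|apply mean_plus;
      [apply mean_plus; [apply (cauchy_formula (z + h) Hzh1)
                        |apply mean_scal, (cauchy_formula z Hz)]
      |apply mean_scal, HD]].
  intros w Hw; cbv beta; unfold kernel.
  assert (H1 : (1 - z * Cconj w)%C <> RtoC 0)
    by (apply one_minus_neq_0; now rewrite Cmod_kernel_arg).
  assert (H2 : (1 - (z + h) * Cconj w)%C <> RtoC 0)
    by (apply one_minus_neq_0; now rewrite Cmod_kernel_arg).
  field; auto. }
replace (q (z + h)%C - q z - h * D)%C with (q (z + h)%C + (- (1)) * q z + (- h) * D)%C by ring.
refine (Cmod_mean_const _ _ _ _ Hm).
intros w Hw.
rewrite !Cmod_mult, !Cmod_pow, Cmod_conj, Hw, pow1, Rmult_1_l.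
assert (Hk1 : Cmod (kernel (z + h) w) <= / e).
{ eapply Rle_trans; [apply Cmod_kernel_le; auto|].
  apply Rinv_le_contravar; [unfold e|]; lra. }
assert (Hk2 := Cmod_kernel_le z w Hz Hw).
replace (B * (/ e * (/ (1 - Cmod z) * / (1 - Cmod z))) * Cmod h ^ 2)
  with (B * (Cmod h ^ 2 * (/ e * (/ (1 - Cmod z) * / (1 - Cmod z))))) by ring.
apply Rmult_le_compat; auto using Cmod_ge_0.
{ apply Rmult_le_pos; [apply pow2_ge_0|]; repeat apply Rmult_le_pos; apply Cmod_ge_0. }
apply Rmult_le_compat_l; [apply pow2_ge_0|].
apply Rmult_le_compat; auto using Cmod_ge_0; [apply Rmult_le_pos; apply Cmod_ge_0|].
apply Rmult_le_compat; auto using Cmod_ge_0.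
Qed.

(** With a = z conj w, kernel^2 = kernel + a kernel^2, so the square of the
    kernel represents q + z q'. *)
Lemma cauchy_formula_kernel2 z : Cmod z < 1 ->
  exists D : C, is_C_derive q z D /\
    mean (fun w => q w * (kernel z w * kernel z w))%C (q z + z * D)%C.
Proof.
intros Hz.
destruct (has_moments_kernel _ z (has_moments_kernel _ z power_series_has_moments Hz) Hz)
  as [_ Hk].
destruct (Hk 1%nat) as [D HD].
assert (HD' : mean (fun w => q w * (Cconj w * (kernel z w * kernel z w)))%C D).
{ eapply mean_ext; [|exact HD]; intros w _; simpl; ring. }
exists D; split; [now apply cauchy_formula_derive|].
eapply mean_ext; [|apply mean_plus; [apply (cauchy_formula z Hz)|apply mean_scal, HD']].
intros w Hw; cbv beta; unfold kernel; field.
apply one_minus_neq_0; now rewrite Cmod_kernel_arg.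
Qed.

End Power_series.

(** Pairing the terms k and N - k, this says that
    (1 - r^(2k+1)) (1 - r^(2(N-k)+1)) >= 0, summed over k.  The induction uses
    instead the lower bound (N + 1) r^(2N+2) of the geometric sum. *)
Lemma geometric_sum_bound (r : R) (N : nat) :
  0 <= r <= 1 ->
  2 * r * sum_n (fun k => (r ^ 2) ^ k) N <= INR (S N) * (1 + (r ^ 2) ^ S N).
Proof.
intros Hr.
set (S2 := sum_n (fun k => (r ^ 2) ^ k)).
assert (Hp : forall k, 0 <= (r ^ 2) ^ k) by (intros k; apply pow_le, pow2_ge_0).
assert (HS : forall M, S2 (S M) = S2 M + (r ^ 2) ^ S M).
{ intros M; unfold S2; now rewrite sum_Sn. }
assert (Hg : forall M, (1 - r ^ 2) * S2 M = 1 - (r ^ 2) ^ S M).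
{ induction M as [|M IH]; [unfold S2; rewrite sum_O; simpl; ring|].
  rewrite HS, Rmult_plus_distr_l, IH; simpl; ring. }
assert (Hlow : forall M, INR (S M) * (r ^ 2) ^ S M <= S2 M).
{ induction M as [|M IH].
  - unfold S2; rewrite sum_O; simpl; nra.
  - rewrite HS, S_INR; pose proof (Hp (S M)).
    assert (0 <= INR (S M)) by apply pos_INR.
    change ((r ^ 2) ^ S (S M)) with (r ^ 2 * (r ^ 2) ^ S M).
    set (x := (r ^ 2) ^ S M) in *; set (n := INR (S M)) in *.
    assert (r ^ 2 <= 1) by nra.
    assert (r ^ 2 * x <= x) by nra.
    assert (n * (r ^ 2 * x) <= n * x) by now apply Rmult_le_compat_l.
    lra. }
induction N as [|N IH].
- unfold S2; rewrite sum_O; simpl; nra.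
- rewrite HS, (S_INR (S N)).
  specialize (Hg N); specialize (Hlow N).
  change ((r ^ 2) ^ S (S N)) with (r ^ 2 * (r ^ 2) ^ S N).
  set (x := (r ^ 2) ^ S N) in *; set (n := INR (S N)) in *.
  assert (Hx : 0 <= x) by apply Hp.
  assert (H1 : (1 - r ^ 2) * (n * x) <= 1 - x).
  { rewrite <- Hg; apply Rmult_le_compat_l; nra. }
  assert (H2 : 0 <= x * (1 - r) ^ 2) by (apply Rmult_le_pos; [exact Hx | apply pow2_ge_0]).
  nra.
Qed.

(** Turns the Schwarz-Pick bound into the bound on the logarithmic derivative;
    M and y stand for the moduli of m and m - 1. *)
Lemma schwarz_pick_to_bound (r M y t : R) (N : nat) :
  0 < r < 1 -> 0 <= M -> 0 <= y -> 0 <= t ->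
  r ^ N * t <= (M ^ 2 - y ^ 2) / (1 - r ^ 2) - M ^ 2 * sum_n (fun k => (r ^ 2) ^ k) N ->
  (t + INR (S N) * (M * y)) * (1 - (r ^ S N) ^ 2) <=
  INR (S N) * r ^ S N * (M ^ 2 - y ^ 2).
Proof.
intros Hr HM Hy Ht H.
assert (HX : 2 * r * sum_n (fun k => (r ^ 2) ^ k) N <= INR (S N) * (1 + (r ^ 2) ^ S N))
  by (apply geometric_sum_bound; lra).
set (T := sum_n (fun k => (r ^ 2) ^ k) N) in *.
assert (Esq : (r ^ 2) ^ S N = (r ^ S N) ^ 2) by (rewrite <- !pow_mult; f_equal; lia).
assert (HT : (1 - r ^ 2) * T = 1 - (r ^ S N) ^ 2).
{ rewrite <- Esq; unfold T; clear.
  induction N as [|N IH]; [rewrite sum_O; simpl; ring|].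
  rewrite sum_Sn; change plus with Rplus.
  rewrite Rmult_plus_distr_l, IH; simpl; ring. }
rewrite Esq in HX.
assert (HR : 0 < r ^ S N < 1) by (split; [apply pow_lt | apply pow_lt_1_compat; [|lia]]; lra).
assert (HRN : r ^ S N = r * r ^ N) by reflexivity.
set (R0 := r ^ S N) in *; set (n := INR (S N)) in *.
assert (Hn : 0 <= n) by apply pos_INR.
assert (Hr2 : 0 < 1 - r ^ 2) by nra.
set (A := R0 * M).
assert (HT0 : 0 <= T) by nra.
assert (H1 : (1 - r ^ 2) * (R0 * t) <= r * (A ^ 2 - y ^ 2)).
{ rewrite HRN.
  replace ((1 - r ^ 2) * (r * r ^ N * t)) with (r * (1 - r ^ 2) * (r ^ N * t)) by ring.
  eapply Rle_trans; [apply Rmult_le_compat_l; [nra | exact H]|].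
  replace (r * (1 - r ^ 2) * ((M ^ 2 - y ^ 2) / (1 - r ^ 2) - M ^ 2 * T))
    with (r * (M ^ 2 - y ^ 2 - M ^ 2 * ((1 - r ^ 2) * T))) by (field; lra).
  rewrite HT; unfold A; right; ring. }
assert (HA : 0 <= A) by (unfold A; nra).
assert (H2 : 0 <= A ^ 2 - y ^ 2).
{ assert (0 <= R0 * t) by nra; nra. }
assert (H3 : y <= A) by nra.
assert (H4 : (R0 * t) * (1 - R0 ^ 2) <= r * T * (A ^ 2 - y ^ 2)).
{ rewrite <- HT; nra. }
assert (H5 : 2 * (r * T) * (A ^ 2 - y ^ 2) <= n * (1 + R0 ^ 2) * (A ^ 2 - y ^ 2))
  by (apply Rmult_le_compat_r; [exact H2 | lra]).
(* Twice the difference of the two sides is at least this square. *)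
assert (H6 : 0 <= n * ((1 - R0 ^ 2) * (A - y) ^ 2)).
{ apply Rmult_le_pos; [exact Hn|]; apply Rmult_le_pos; [nra | apply pow2_ge_0]. }
apply Rmult_le_reg_l with R0; [lra|].
replace (R0 * ((t + n * (M * y)) * (1 - R0 ^ 2)))
  with (R0 * t * (1 - R0 ^ 2) + n * A * y * (1 - R0 ^ 2)) by (unfold A; ring).
replace (R0 * (n * R0 * (M ^ 2 - y ^ 2))) with (n * (A ^ 2 - R0 ^ 2 * y ^ 2))
  by (unfold A; ring).
lra.
Qed.

(** The sharp bound for the logarithmic derivative, for functions whose power
    series converges absolutely on the closed disk. *)
Theorem positive_real_part_bound (d : nat -> C) (q : C -> C) (N : nat) (z : C) :
  ex_series (fun k => Cmod (d k)) ->
  (forall z, Cmod z <= 1 ->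
     is_series (V := C_NormedModule) (fun k => z ^ k * d k)%C (q z)) ->
  d 0%nat = RtoC 1 -> (forall k, (1 <= k <= N)%nat -> d k = RtoC 0) ->
  (forall w, on_circle w -> 0 <= Re (q w)) -> Cmod z < 1 ->
  exists D : C, is_C_derive q z D /\
    Cmod (z * D) * (1 - (Cmod z ^ S N) ^ 2) <=
    2 * INR (S N) * Cmod z ^ S N * Re (q z).
Proof.
intros Hd Hq Hd0 HdN Hpos Hz.
destruct (cauchy_formula_kernel2 d q Hd Hq z Hz) as [D [HD HV]].
exists D; split; [exact HD|].
destruct (Req_dec (Cmod z) 0) as [Hz0|Hz0].
{ rewrite Cmod_mult, Hz0; simpl; right; ring. }
assert (Hr : 0 < Cmod z < 1) by (pose proof (Cmod_ge_0 z); lra).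
set (u := fun w => Re (q w)).
(* The weight is the half sum of q and its conjugate. *)
assert (Hw : forall g v v', mean (fun w => q w * g w)%C v ->
  mean (fun w => Cconj (q w) * g w)%C v' -> wmean u g (/ 2 * (v + v'))%C).
{ intros g v v' H1 H2.
  eapply mean_ext; [|apply mean_scal, mean_plus; [exact H1 | exact H2]].
  intros w _; cbv beta; unfold u; rewrite re_alt; field; intros H; apply RtoC_inj in H; lra. }
assert (Ha := power_series_conj_antianalytic d q Hd Hq).
rewrite Hd0, Cconj_RtoC in Ha.
assert (Ha1 := antianalytic_kernel _ _ z Ha Hz).
assert (Ha2 := antianalytic_kernel _ _ z Ha1 Hz).
set (m := (/ 2 * (q z + 1))%C).
assert (H20 : RtoC 2 <> RtoC 0) by (intros H; apply RtoC_inj in H; lra).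
assert (Hker : wmean u (kernel z) m).
{ apply Hw; [now apply (cauchy_formula d) | apply Ha1]. }
assert (Hker2 : wmean u (fun w => kernel z w * kernel z w)%C (/ 2 * (q z + z * D + 1))%C).
{ apply Hw; [exact HV|].
  eapply mean_ext; [|apply Ha2]; intros w _; simpl; ring. }
assert (Hone : wmean u (fun _ => RtoC 1) 1).
{ assert (E : RtoC 1 = (/ 2 * (d 0%nat + 1))%C) by (rewrite Hd0; field; auto).
  apply (eq_ind_r (wmean u (fun _ => RtoC 1))) with (2 := E); apply Hw.
  - eapply mean_ext; [|apply (power_series_moment d q Hd Hq 0)]; intros w _; simpl; ring.
  - eapply mean_ext; [|apply Ha]; intros w _; simpl; ring. }
assert (Hpow : forall k, (1 <= k <= N)%nat -> wmean u (fun w => Cconj w ^ k)%C 0).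
{ intros k Hk; replace (RtoC 0) with (/ 2 * (d k + 0))%C by (rewrite HdN by exact Hk; ring).
  apply Hw; [apply (power_series_moment d q Hd Hq k)|].
  destruct k as [|k]; [lia | apply Ha]. }
assert (HSP := schwarz_pick_moments u z N m _ Hpos Hz Hone Hpow Hker Hker2 (proj1 Hr)).
set (t := Cmod (/ 2 * (q z + z * D + 1) + INR N * m - INR (S N) * (m * m))) in HSP.
assert (HMy : Re (q z) = Cmod m ^ 2 - Cmod (m - 1) ^ 2).
{ rewrite !Cmod2_alt; unfold m; destruct (q z) as [x y].
  replace (/ 2)%C with (RtoC (/ 2)) by (rewrite RtoC_inv; [reflexivity | lra]).
  simpl; field. }
assert (Hm : 2 * Re m - 1 = Re (q z)).
{ unfold m; replace (/ 2)%C with (RtoC (/ 2)) by (rewrite RtoC_inv; [reflexivity | lra]).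
  rewrite re_scal_l, re_plus, re_RtoC; field. }
rewrite Hm, HMy in HSP.
assert (Hb := schwarz_pick_to_bound _ _ _ _ N Hr (Cmod_ge_0 m) (Cmod_ge_0 (m - 1)%C)
                (Cmod_ge_0 _) HSP).
rewrite <- HMy in Hb.
assert (HzD : Cmod (z * D) <= 2 * (t + INR (S N) * (Cmod m * Cmod (m - 1)))).
{ replace (z * D)%C with
    (2 * ((/ 2 * (q z + z * D + 1) + INR N * m - INR (S N) * (m * m)) +
          INR (S N) * (m * (m - 1))))%C
    by (unfold m; rewrite S_INR, RtoC_plus; field; auto).
  rewrite Cmod_mult, Cmod_R, Rabs_pos_eq by lra.
  apply Rmult_le_compat_l; [lra|].
  eapply Rle_trans; [apply Cmod_triangle|]; apply Rplus_le_compat_l.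
  rewrite !Cmod_mult, Cmod_R, Rabs_pos_eq by apply pos_INR; right; ring. }
assert (HR : Cmod z ^ S N < 1) by (apply pow_lt_1_compat; [lra | lia]).
assert (HR0 : 0 <= Cmod z ^ S N) by (apply pow_le; lra).
apply Rle_trans with
  (2 * (t + INR (S N) * (Cmod m * Cmod (m - 1))) * (1 - (Cmod z ^ S N) ^ 2)).
- apply Rmult_le_compat_r; [nra | exact HzD].
- rewrite Rmult_assoc; fold t in Hb; lra.
Qed.

(** * Functions of the class and their dilations *)

(** At a point rho' between rho and 1 the terms of the convergent series are
    bounded, so those at rho are dominated by a geometric series of ratio
    rho / rho'. *)
Lemma ex_series_dilation (c : nat -> C) (rho : R) :
  0 < rho < 1 ->
  (forall z, Cmod z < 1 ->
     exists l, is_series (V := C_NormedModule) (fun k => z ^ k * c k)%C l) ->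
  ex_series (fun k => Cmod (rho ^ k * c k)).
Proof.
intros Hrho Hc; set (rho' := (1 + rho) / 2).
assert (Hr' : rho < rho' < 1) by (unfold rho'; lra).
destruct (Hc (RtoC rho')) as [l Hl].
{ rewrite Cmod_R, Rabs_pos_eq; lra. }
assert (H1 := proj1 (Clim_iff _ _) Hl (mkposreal 1 Rlt_0_1)).
destruct H1 as [N0 HN0]; simpl in HN0.
apply (ex_series_incr_n (V := R_NormedModule) _ (S N0)).
apply (ex_series_le (V := R_CompleteNormedModule) _
         (fun k => 2 * (rho / rho') ^ S N0 * (rho / rho') ^ k)).
- intros k; rewrite Rmult_assoc, <- pow_add.
  change (norm ?x) with (Rabs x); rewrite Rabs_pos_eq by apply Cmod_ge_0.
  set (j := (S N0 + k)%nat).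
  assert (Hj : Cmod (rho' ^ j * c j) <= 2).
  { assert (E : (rho' ^ j * c j)%C =
      ((sum_n (fun k => RtoC rho' ^ k * c k)%C j - l) -
       (sum_n (fun k => RtoC rho' ^ k * c k)%C (pred j) - l))%C).
    { change (pred j) with (N0 + k)%nat; change j with (S (N0 + k)).
      rewrite sum_n_C_S; ring. }
    rewrite E; unfold Cminus at 1; eapply Rle_trans; [apply Cmod_triangle|].
    rewrite Cmod_opp.
    assert (A1 := HN0 j); assert (A2 := HN0 (pred j)); unfold j in A1, A2 |- *.
    simpl pred in *; specialize (A1 ltac:(lia)); specialize (A2 ltac:(lia)).
    apply Rlt_le; replace 2 with (1 + 1) by ring; apply Rplus_lt_compat; assumption. }
  rewrite Cmod_mult, Cmod_pow, Cmod_R, Rabs_pos_eq in Hj |- * by lra.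
  unfold Rdiv; rewrite Rpow_mult_distr, pow_inv.
  assert (0 < rho ^ j) by (apply pow_lt; lra).
  assert (Hp : 0 < rho' ^ j) by (apply pow_lt; lra).
  apply Rmult_le_reg_r with (1 := Hp).
  replace (2 * (rho ^ j * / rho' ^ j) * rho' ^ j) with (rho ^ j * 2) by (field; lra).
  rewrite Rmult_assoc; apply Rmult_le_compat_l; lra.
- apply (ex_series_scal (V := R_NormedModule)), ex_series_geom.
  assert (0 < rho / rho') by (apply Rdiv_lt_0_compat; lra).
  rewrite Rabs_pos_eq by lra; apply Rlt_div_l; lra.
Qed.

(** The bound at z / rho for the dilated function p(rho x), whose power series
    converges absolutely on the closed disk. *)
Lemma class_P_bound (n : nat) (p : C -> C) (z : C) (rho : R) :
  (1 <= n)%nat -> class_P n p -> Cmod z < rho < 1 ->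
  exists D : C, is_C_derive p z D /\
    Cmod (z * D) * (1 - ((Cmod z / rho) ^ n) ^ 2) <=
    2 * INR n * (Cmod z / rho) ^ n * Re (p z).
Proof.
intros Hn [_ [[c [Hc0 [Hcn Hc]]] Hp]] Hz.
destruct n as [|N]; [lia|].
assert (Hz0 := Cmod_ge_0 z).
assert (Hrho : RtoC rho <> RtoC 0) by (intros H; apply RtoC_inj in H; lra).
assert (Hdisk : forall x, Cmod x <= 1 -> disk 1 (rho * x)).
{ intros x Hx; unfold disk; rewrite Cmod_mult, Cmod_R, Rabs_pos_eq by lra; nra. }
set (q := fun x => p (rho * x)%C).
set (d := fun k => (rho ^ k * c k)%C).
assert (Hzr : Cmod (z / rho) = Cmod z / rho)
  by (rewrite Cmod_div, Cmod_R, Rabs_pos_eq by (auto; lra); reflexivity).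
destruct (positive_real_part_bound d q N (z / rho)%C) as [D [HD HB]].
- apply ex_series_dilation; [lra|]; intros x Hx; exists (p x); exact (Hc x Hx).
- intros x Hx; eapply (is_series_ext (V := C_NormedModule)); [|exact (Hc _ (Hdisk x Hx))].
  intros k; unfold d; change scal with Cmult; eq_in_C.
  change (pow_n (K := C_AbsRing) (rho * x)%C k) with ((rho * x) ^ k)%C.
  rewrite Cpow_mult_l; ring.
- unfold d; rewrite Hc0; simpl; ring.
- intros k Hk; unfold d; rewrite Hcn by lia; ring.
- intros w Hw; apply Rlt_le, Hp, Hdisk; right; exact Hw.
- rewrite Hzr; apply Rlt_div_l; lra.
- exists (/ rho * D)%C; rewrite Hzr in HB; split.
  + apply (is_derive_ext (K := C_AbsRing) (V := C_NormedModule) (fun x => q (/ rho * x)%C)).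
    { intros x; unfold q; f_equal; field; exact Hrho. }
    replace (z / rho)%C with (/ rho * z)%C in HD by (field; exact Hrho).
    assert (Hl := is_C_derive_mult _ _ z _ _ (is_C_derive_const (/ rho)%C z) (is_C_derive_id z)).
    cbv beta in Hl; replace (0 * z + / rho * 1)%C with (/ rho)%C in Hl by ring.
    exact (is_C_derive_comp q _ z _ _ HD Hl).
  + replace (z * (/ rho * D))%C with (z / rho * D)%C by (field; exact Hrho).
    replace (Re (p z)) with (Re (q (z / rho)%C)); [exact HB|].
    unfold q; f_equal; f_equal; field; exact Hrho.
Qed.

(** * The radius *)

Lemma log_quot_mult_id (f p : C -> C) (z D : C) :
  (forall x, f x = (x * p x)%C) -> is_C_derive p z D -> z <> RtoC 0 ->
  p z <> RtoC 0 -> log_quot f z = (1 + z * D / p z)%C.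
Proof.
intros Hf HD Hz Hpz; unfold log_quot.
destruct (Ceq_dec z 0) as [E|_]; [contradiction|].
assert (Hd : is_C_derive f z (1 * p z + z * D)%C).
{ apply (is_derive_ext (K := C_AbsRing) (V := C_NormedModule) (fun x => x * p x)%C).
  - intros x; symmetry; apply Hf.
  - exact (is_C_derive_mult _ _ z _ _ (is_C_derive_id z) HD). }
rewrite (is_C_derive_unique _ _ _ Hd), Hf; field; auto.
Qed.

Lemma SL_cond_of_small (f : C -> C) (z w : C) (t : R) :
  log_quot f z = (1 + w)%C -> Cmod w <= t -> t < sqrt 2 - 1 -> SL_cond f z.
Proof.
intros E Hw Ht; unfold SL_cond; rewrite E.
replace ((1 + w) * (1 + w) - 1)%C with (w * (w + 2))%C by ring.
rewrite Cmod_mult.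
assert (H2 : Cmod (w + 2) <= t + 2).
{ eapply Rle_trans; [apply Cmod_triangle|]; rewrite (Cmod_R 2), Rabs_pos_eq; lra. }
assert (Hs : sqrt 2 * sqrt 2 = 2) by (apply sqrt_sqrt; lra).
pose proof (Cmod_ge_0 w); pose proof (Cmod_ge_0 (w + 2)); pose proof (sqrt_pos 2).
apply Rle_lt_trans with (t * (t + 2)); [apply Rmult_le_compat; auto|]; nra.
Qed.

(** The n-th power of the radius: the positive root x of
    (sqrt 2 - 1) (1 - x^2) = 2 n x. *)
Definition radius_pow (n : nat) : R :=
  (sqrt 2 - 1) / (INR n + sqrt (INR n ^ 2 + (sqrt 2 - 1) ^ 2)).

Lemma sqrt2_bounds : 1 < sqrt 2 < 2.
Proof.
assert (Hs : sqrt 2 * sqrt 2 = 2) by (apply sqrt_sqrt; lra).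
pose proof (sqrt_pos 2); split; nra.
Qed.

Lemma radius_pow_spec (n : nat) :
  (1 <= n)%nat ->
  0 < radius_pow n < 1 /\
  2 * INR n * radius_pow n = (sqrt 2 - 1) * (1 - radius_pow n ^ 2).
Proof.
intros Hn; unfold radius_pow.
pose proof sqrt2_bounds as Hs.
assert (Hn1 : 1 <= INR n) by (apply (le_INR 1); exact Hn).
set (s := sqrt 2 - 1) in *; set (x := INR n) in *.
assert (Hs0 : 0 < s < 1) by (unfold s; lra).
assert (Hpos : 0 <= x ^ 2 + s ^ 2) by nra.
pose proof (sqrt_pos (x ^ 2 + s ^ 2)) as HQ0.
assert (HQ := sqrt_sqrt _ Hpos).
set (Q := sqrt (x ^ 2 + s ^ 2)) in *.
split; [split|].
- apply Rdiv_lt_0_compat; lra.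
- apply Rlt_div_l; lra.
- assert (E : s ^ 2 = (Q - x) * (Q + x)) by nra.
  apply Rmult_eq_reg_r with ((x + Q) ^ 2); [|apply pow_nonzero; lra].
  field_simplify; [|lra|lra]; nra.
Qed.

Lemma radius_spec (n : nat) :
  (1 <= n)%nat ->
  let R0 := Rpower (radius_pow n) (1 / INR n) in
  0 < R0 < 1 /\ R0 ^ n = radius_pow n.
Proof.
intros Hn R0.
destruct (radius_pow_spec n Hn) as [HB _].
assert (Hn1 : 1 <= INR n) by (apply (le_INR 1); exact Hn).
assert (HR0 : 0 < R0) by apply exp_pos.
assert (E : R0 ^ n = radius_pow n).
{ rewrite <- Rpower_pow by exact HR0; unfold R0; rewrite Rpower_mult.
  replace (1 / INR n * INR n) with 1 by (field; lra); apply Rpower_1; lra. }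
split; [split; [exact HR0|]|exact E].
destruct (Rlt_le_dec R0 1) as [H|H]; [exact H|].
pose proof (pow_R1_Rle R0 n H); lra.
Qed.

Lemma class_S_SL_cond (n : nat) (f : C -> C) (z : C) :
  (1 <= n)%nat -> class_S n f ->
  Cmod z < Rpower (radius_pow n) (1 / INR n) -> SL_cond f z.
Proof.
intros Hn [[_ [a [Ha0 [_ [_ Ha]]]]] HP] Hz.
destruct (radius_spec n Hn) as [HR0 ER0].
destruct (radius_pow_spec n Hn) as [HB EB].
set (R0 := Rpower _ _) in *; set (B := radius_pow n) in *.
pose proof sqrt2_bounds as Hs; pose proof (Cmod_ge_0 z) as Hz0.
destruct (Ceq_dec z 0) as [->|Hznz].
{ apply SL_cond_of_small with (w := RtoC 0) (t := 0).
  - unfold log_quot; destruct (Ceq_dec 0 0) as [_|E]; [ring | now elim E].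
  - rewrite Cmod_0; lra.
  - lra. }
assert (Hf : forall x, f x = (x * over_id f x)%C).
{ intros x; unfold over_id; destruct (Ceq_dec x 0) as [->|Hx]; [|field; exact Hx].
  assert (H0 := Ha (RtoC 0)); unfold disk in H0; rewrite Cmod_0 in H0.
  specialize (H0 Rlt_0_1).
  rewrite (Clim_unique _ _ _ H0
             (is_pseries_0 (K := C_AbsRing) (V := C_NormedModule) a)), Ha0; ring. }
(* Any dilation factor strictly between |z| / R0 and 1 will do. *)
set (rho := (Cmod z / R0 + 1) / 2).
assert (Hq : Cmod z / R0 < 1) by (apply Rlt_div_l; lra).
assert (Hq0 : 0 <= Cmod z / R0) by (apply Rmult_le_pos; [lra | apply Rlt_le, Rinv_0_lt_compat; lra]).
assert (Hqz : Cmod z = Cmod z / R0 * R0) by (field; lra).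
assert (Hrho : Cmod z < rho * R0) by (unfold rho; nra).
assert (Hrho1 : 0 < rho < 1) by (unfold rho; lra).
destruct (class_P_bound n (over_id f) z rho Hn HP) as [D [HD HDB]]; [nra|].
assert (Hpos : 0 < Re (over_id f z)) by (apply HP; unfold disk; lra).
assert (Hnz : over_id f z <> RtoC 0) by (intros E; rewrite E in Hpos; simpl in Hpos; lra).
set (x := (Cmod z / rho) ^ n) in *.
assert (Hx : 0 <= x < B).
{ assert (H1 : 0 <= Cmod z / rho) by (apply Rmult_le_pos; [lra | apply Rlt_le, Rinv_0_lt_compat; lra]).
  assert (H2 : Cmod z / rho < R0) by (apply Rlt_div_l; lra).
  unfold x; rewrite <- ER0; split; [now apply pow_le|].
  destruct n as [|k]; [lia|].
  apply Rle_lt_trans with (R0 ^ k * (Cmod z / rho)).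
  - rewrite <- tech_pow_Rmult, Rmult_comm; apply Rmult_le_compat_r; [exact H1|].
    apply pow_incr; lra.
  - simpl; rewrite (Rmult_comm R0); apply Rmult_lt_compat_l; [apply pow_lt; lra | exact H2]. }
assert (Hn1 : 1 <= INR n) by (apply (le_INR 1); exact Hn).
assert (Hx2 : 0 < 1 - x ^ 2) by nra.
apply SL_cond_of_small with (w := (z * D / over_id f z)%C)
  (t := 2 * INR n * x / (1 - x ^ 2)).
- now apply log_quot_mult_id.
- rewrite Cmod_div by exact Hnz.
  assert (Hm : Re (over_id f z) <= Cmod (over_id f z))
    by (eapply Rle_trans; [apply Rle_abs | apply re_le_Cmod]).
  apply Rle_div_l; [lra|].
  replace (2 * INR n * x / (1 - x ^ 2) * Cmod (over_id f z))
    with (2 * INR n * x * Cmod (over_id f z) / (1 - x ^ 2)) by (field; lra).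
  apply Rle_div_r; [exact Hx2|].
  eapply Rle_trans; [exact HDB|]; apply Rmult_le_compat_l; [nra | exact Hm].
- apply Rlt_div_l; [exact Hx2|].
  assert (H1 : x ^ 2 <= B ^ 2) by (apply pow_incr; lra).
  assert (H2 : INR n * x < INR n * B) by (apply Rmult_lt_compat_l; lra).
  assert (H3 : (sqrt 2 - 1) * (1 - B ^ 2) <= (sqrt 2 - 1) * (1 - x ^ 2))
    by (apply Rmult_le_compat_l; lra).
  lra.
Qed.

(** * The extremal function *)

(** The member of P_n that maps the disk n times over the right half-plane. *)
Definition half_plane_map (n : nat) (z : C) : C := ((1 + z ^ n) * / (1 - z ^ n))%C.

(** The expansion is 1 + 2 z^n + 2 z^(2n) + ..., that is, twice a geometric
    series minus 1. *)
Definition half_plane_coef (n k : nat) : C :=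
  ((if Nat.eqb (k mod n) 0 then 2 else 0) - (if Nat.eqb k 0 then 1 else 0))%C.

Lemma Cmod_pow_lt_1 (n : nat) (z : C) : (1 <= n)%nat -> Cmod z < 1 -> Cmod (z ^ n) < 1.
Proof.
intros Hn Hz; rewrite Cmod_pow; apply pow_lt_1_compat; [|lia].
split; [apply Cmod_ge_0 | exact Hz].
Qed.

Lemma half_plane_map_series (n : nat) (z : C) :
  (1 <= n)%nat -> Cmod z < 1 ->
  is_pseries (K := C_AbsRing) (V := C_NormedModule)
    (half_plane_coef n) z (half_plane_map n z).
Proof.
intros Hn Hz.
assert (Hne := one_minus_neq_0 _ (Cmod_pow_lt_1 n z Hn Hz)).
assert (H := is_series_plus (V := C_NormedModule) _ _ _ _
  (is_series_scal (V := C_NormedModule) (RtoC 2) _ _ (is_series_lacunary_geom n z Hn Hz))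
  (is_series_single (fun _ => (- (1))%C) 0)).
change plus with Cplus in H; change scal with Cmult in H.
replace (half_plane_map n z) with (2 * / (1 - z ^ n) + - (1))%C
  by (unfold half_plane_map; field; exact Hne).
revert H; apply is_series_ext; intros k.
change scal with Cmult; change (pow_n (K := C_AbsRing) z k) with (z ^ k)%C.
unfold half_plane_coef; eq_in_C.
destruct k as [|k]; [rewrite Nat.Div0.mod_0_l; simpl; ring|].
simpl (S k =? 0)%nat; destruct Nat.eqb; ring.
Qed.

Lemma half_plane_map_derive (n : nat) (z : C) :
  (1 <= n)%nat -> Cmod z < 1 ->
  exists D : C, is_C_derive (half_plane_map n) z D /\
    (z * D)%C = (2 * INR n * z ^ n / ((1 - z ^ n) * (1 - z ^ n)))%C.
Proof.
intros Hn Hz.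
assert (Hne := one_minus_neq_0 _ (Cmod_pow_lt_1 n z Hn Hz)).
destruct n as [|k]; [lia|].
assert (Hpow := is_C_derive_pow z k).
assert (Hnum : is_C_derive (fun x => 1 + x ^ S k)%C z (0 + INR (S k) * z ^ k)%C)
  by exact (is_C_derive_plus _ _ z _ _ (is_C_derive_const 1 z) Hpow).
assert (Hden : is_C_derive (fun x => 1 + (- (1)) * x ^ S k)%C z
                 (0 + (0 * z ^ S k + (- (1)) * (INR (S k) * z ^ k)))%C)
  by exact (is_C_derive_plus _ _ z _ _ (is_C_derive_const 1 z)
             (is_C_derive_mult _ _ z _ _ (is_C_derive_const (- (1))%C z) Hpow)).
replace (1 - z ^ S k)%C with (1 + (- (1)) * z ^ S k)%C in * by ring.
assert (Hinv := is_C_derive_comp Cinv _ z _ _ (is_C_derive_Cinv _ Hne) Hden).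
assert (H := is_C_derive_mult _ _ z _ _ Hnum Hinv).
cbv beta in H; eexists; split.
- eapply (is_derive_ext (K := C_AbsRing) (V := C_NormedModule)); [|exact H].
  assert (E : forall x : C, ((1 + x ^ S k) * / (1 + - (1) * x ^ S k))%C =
                            half_plane_map (S k) x).
  { intros x; unfold half_plane_map; do 2 f_equal; ring. }
  exact E.
- rewrite (Cpow_S z k) in Hne |- *; field.
  intros E; apply Hne; rewrite <- E; ring.
Qed.

Lemma Re_half_plane_map (n : nat) (z : C) :
  (1 <= n)%nat -> Cmod z < 1 -> 0 < Re (half_plane_map n z).
Proof.
intros Hn Hz; assert (Hu := Cmod_pow_lt_1 n z Hn Hz).
assert (Hne := one_minus_neq_0 _ Hu); unfold half_plane_map.
set (u := (z ^ n)%C) in *.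
assert (Hp : 0 < Cmod (1 - u)) by now apply Cmod_gt_0.
replace ((1 + u) * / (1 - u))%C
  with (RtoC (/ Cmod (1 - u) ^ 2) * ((1 + u) * Cconj (1 - u)))%C.
2:{ rewrite RtoC_inv by (apply pow_nonzero; lra).
    rewrite Cmod2_conj; field; split; [exact Hne|].
    intros E; apply Hne; rewrite <- (Cconj_conj (1 - u)), E; apply Cconj_RtoC. }
rewrite re_scal_l; apply Rmult_lt_0_compat.
{ apply Rinv_0_lt_compat, pow_lt, Hp. }
replace (Re ((1 + u) * Cconj (1 - u))) with (1 - Cmod u ^ 2).
2:{ rewrite Cmod2_alt; destruct u as [x y]; simpl; ring. }
pose proof (Cmod_ge_0 u); nra.
Qed.

Definition extremal (n : nat) (z : C) : C := (z * half_plane_map n z)%C.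

Lemma over_id_extremal (n : nat) (z : C) :
  (1 <= n)%nat -> over_id (extremal n) z = half_plane_map n z.
Proof.
intros Hn; unfold over_id, extremal; destruct (Ceq_dec z 0) as [->|Hz].
- unfold half_plane_map; destruct n as [|k]; [lia|]; rewrite Cpow_S; field.
- field; exact Hz.
Qed.

Lemma extremal_class_S (n : nat) : (1 <= n)%nat -> class_S n (extremal n).
Proof.
intros Hn; split; split.
- intros z Hz; destruct (half_plane_map_derive n z Hn Hz) as [D [HD _]].
  exists (1 * half_plane_map n z + z * D)%C.
  exact (is_C_derive_mult _ _ z _ _ (is_C_derive_id z) HD).
- exists (PS_incr_1 (V := C_NormedModule) (half_plane_coef n)); split; [reflexivity|split; [|split]].
  + simpl; unfold half_plane_coef; rewrite Nat.Div0.mod_0_l; simpl; ring.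
  + intros [|[|k]] Hk; [lia | lia |]; simpl; unfold half_plane_coef.
    rewrite Nat.mod_small by lia; simpl; ring.
  + intros z Hz.
    exact (is_pseries_incr_1 (K := C_AbsRing) (V := C_NormedModule) _ z _
             (half_plane_map_series n z Hn Hz)).
- intros z Hz; destruct (half_plane_map_derive n z Hn Hz) as [D [HD _]].
  exists D; eapply (is_derive_ext (K := C_AbsRing) (V := C_NormedModule)); [|exact HD].
  intros x; symmetry; now apply over_id_extremal.
- split.
  + exists (half_plane_coef n); split; [|split].
    * unfold half_plane_coef; rewrite Nat.Div0.mod_0_l; simpl; ring.
    * intros [|k] Hk; [lia|]; unfold half_plane_coef.
      rewrite Nat.mod_small by lia; simpl; ring.
    * intros z Hz; rewrite over_id_extremal by exact Hn.
      now apply half_plane_map_series.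
  + intros z Hz; rewrite over_id_extremal by exact Hn; now apply Re_half_plane_map.
Qed.

(** At the radius the logarithmic quotient is 1 + 2 n x / (1 - x^2) = sqrt 2,
    with x the n-th power of the radius, and (sqrt 2)^2 - 1 = 1. *)
Lemma extremal_not_SL_cond (n : nat) :
  (1 <= n)%nat ->
  ~ SL_cond (extremal n) (RtoC (Rpower (radius_pow n) (1 / INR n))).
Proof.
intros Hn.
destruct (radius_spec n Hn) as [HR0 ER0].
destruct (radius_pow_spec n Hn) as [HB EB].
set (R0 := Rpower _ _) in *; set (B := radius_pow n) in *.
assert (Hz : Cmod (RtoC R0) < 1) by (rewrite Cmod_R, Rabs_pos_eq; lra).
destruct (half_plane_map_derive n R0 Hn Hz) as [D [HD ED]].
assert (Hpos := Re_half_plane_map n R0 Hn Hz).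
assert (Ez : (RtoC R0 ^ n)%C = RtoC B) by (rewrite <- RtoC_pow, ER0; reflexivity).
assert (H1 : (1 - RtoC B)%C <> RtoC 0)
  by (rewrite <- RtoC_minus; intros E; apply RtoC_inj in E; lra).
assert (H2 : (1 + RtoC B)%C <> RtoC 0)
  by (rewrite <- RtoC_plus; intros E; apply RtoC_inj in E; lra).
unfold SL_cond; rewrite (log_quot_mult_id _ (half_plane_map n) _ D); auto.
- rewrite ED; unfold half_plane_map; rewrite Ez.
  replace (1 + 2 * INR n * B / ((1 - B) * (1 - B)) / ((1 + B) * / (1 - B)))%C
    with (RtoC (sqrt 2)).
  + rewrite <- RtoC_mult, sqrt_sqrt, <- RtoC_minus, Cmod_R, Rabs_pos_eq by lra; lra.
  + replace (sqrt 2) with (1 + 2 * INR n * B / ((1 - B) * (1 + B))).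
    2:{ rewrite EB; field; lra. }
    rewrite RtoC_plus, RtoC_div, !RtoC_mult, RtoC_minus, RtoC_plus by nra.
    field; auto.
- intros E; apply RtoC_inj in E; lra.
- intros E; rewrite E in Hpos; simpl in Hpos; lra.
Qed.

Theorem theorem2p1 (n : nat) (hn : (1 <= n)%nat) :
  is_SL_radius n (class_S n)
    (Rpower ((sqrt 2 - 1) / (INR n + sqrt (INR n ^ 2 + (sqrt 2 - 1) ^ 2)))
            (1 / INR n)).
Proof.
fold (radius_pow n); destruct (radius_spec n hn) as [HR0 _].
set (R0 := Rpower _ _) in *.
split; [|split].
- intros f Hf; apply Hf.
- split; [lra|]; intros f Hf r Hr z Hz; apply (class_S_SL_cond n); auto.
  unfold disk in Hz; fold R0; lra.
- intros R1 [HR1 H]; destruct (Rle_lt_dec R1 R0) as [Hle|Hlt]; [exact Hle|].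
  exfalso; apply (extremal_not_SL_cond n hn); fold R0.
  apply (H _ (extremal_class_S n hn) ((R0 + R1) / 2)); [lra|].
  unfold disk; rewrite Cmod_R, Rabs_pos_eq; lra.
Qed.
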